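(* Let $n\in\mathbb{N}$, $n\ge1$, and let $p,q\in[1,\infty]$ with $p^{-1}+q^{-1}=1$. If $K\in L_q$, then $$\mathcal{U}\left(K*\Phi_p,SVH^T_{2n-1}\right)_{L^A_\infty}=E\left(K,H^{T}_{2n-1}\right)_{L_q}.$$
   Context: Scalar notation. $L_p$ ($1\le p\le\infty$) is the space of $2\pi$-periodic functions $f:\mathbb{R}\to\mathbb{R}$ with the usual norm $\|f\|_{L_p}=\left(\int_0^{2\pi}|f(x)|^p\,dx\right)^{1/p}$ (essential supremum for $p=\infty$). $H^T_{2n-1}$ is the $(2n-1)$-dimensional space of real trigonometric polynomials of order at most $n-1$, i.e. of functions $\frac{a_0}{2}+\sum_{k=1}^{n-1}(a_k\cos kx+b_k\sin kx)$, $a_k,b_k\in\mathbb{R}$. For $f\in L_q$, $E(f,H^T_{2n-1})_{L_q}=\inf_{T\in H^T_{2n-1}}\|f-T\|_{L_q}$. Set-valued notation. Fix $m\ge1$. $K(\mathbb{R}^m)$ is the set of nonempty compact subsets of $\mathbb{R}^m$, with the Hausdorff metric $\delta$ induced by the Euclidean norm; $\theta$ is the zero vector of $\mathbb{R}^m$ and $\|A\|=\delta(A,\{\theta\})$ for $A\in K(\mathbb{R}^m)$. For $\lambda\in\mathbb{R}$, $\lambda A=\{\lambda a:a\in A\}$. For set-valued $f:[0,2\pi]\to K(\mathbb{R}^m)$ the integral is the Aumann integral $\int_0^{2\pi}f(x)\,dx=\left\{\int_0^{2\pi}\phi(x)\,dx:\ \phi(x)\in f(x)\text{ a.e.},\ \phi\text{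 integrable}\right\}$. $L_1^A$ is the set of measurable $2\pi$-periodic functions $f:\mathbb{R}\to K(\mathbb{R}^m)$ with $\|f(\cdot)\|$ integrable on $[0,2\pi]$; for $1\le p\le\infty$, $L_p^A=\{f\in L_1^A:\|f(\cdot)\|\in L_p\}$, with metric $\delta_{L_p^A}(f,g)=\|\delta(f(\cdot),g(\cdot))\|_{L_p}$. Put $\Phi_p=\{f\in L_p^A:\delta_{L_p^A}(f,\{\theta\})\le1\}$, where $\{\theta\}$ denotes the constant function. For $K\in L_q$ and $g\in L_p^A$, $K*g(x)=\int_0^{2\pi}K(x-t)g(t)\,dt$ (Aumann integral), and $K*\Phi_p=\{K*g:g\in\Phi_p\}$; $T*g$ for $T\in H^T_{2n-1}$ is defined in the same way. Here $SVH^T_{2n-1}$ denotes the set of all set-valued functions $\tau(x)=\int_0^{2\pi}T(x-t)h(t)\,dt$ with $T\in H^T_{2n-1}$, $h\in L_1^A$. Define $$\mathcal{U}(K*\Phi_p,SVH^T_{2n-1})_{L^A_\infty}=\inf_{T\in H^T_{2n-1}}\ \sup_{g\in\Phi_p}\delta_{L^A_\infty}(K*g,T*g).$$ *)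

(* Defs.v *)
From mathcomp Require Import all_boot all_order all_algebra.
From mathcomp Require Import all_classical all_reals all_analysis.

Set Implicit Arguments.
Unset Strict Implicit.
Unset Printing Implicit Defensive.

Import Order.TTheory GRing.Theory Num.Theory.
Import numFieldNormedType.Exports.

Local Open Scope classical_set_scope.
Local Open Scope ring_scope.

(* The real line with the sigma-algebra of all Lebesgue measurable sets (the
   default measurable structure on R is the Borel one); convertible to R. *)
Definition lebR (R : realType) :=
  caratheodory_type ((wlength (idfun : R -> R))^*)%mu.

Definition leb (R : realType) : {measure set (lebR R) -> \bar R} :=
  @completed_lebesgue_measure R.

Definition period (R : realType) : set (lebR R) :=
  (`[0, pi *+ 2]%classic : set R).

Section Scalar.
Context {R : realType}.

(* f is extended by 0 outside [0, 2 pi], so this is the norm over one period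
   for every p with 1 <= p <= +oo (ess. sup for p = +oo). *)
Definition Lp_norm (p : \bar R) (f : R -> \bar R) : \bar R :=
  'N[leb R]_p [(f : lebR R -> \bar R) \_ (@period R)].

Definition Lp (p : \bar R) (f : R -> R) : Prop :=
  [/\ measurable_fun [set: lebR R] (f : lebR R -> R),
      periodic f (pi *+ 2) &
      (Lp_norm p (EFin \o f) < +oo)%E].

(* Order at most n - 1; the value b 0 is irrelevant. *)
Definition trig_poly (n : nat) : set (R -> R) :=
  [set T | exists a b : nat -> R, forall x,
     T x = a 0%N / 2 +
       \sum_(1 <= k < n) (a k * cos (k%:R * x) + b k * sin (k%:R * x))].

Definition best_approx (n : nat) (q : \bar R) (f : R -> R) : \bar R :=
  ereal_inf [set Lp_norm q (fun x => (f x - T x)%:E) | T in trig_poly n].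

End Scalar.

Section SetValued.
Context {R : realType} {m : nat}.
Implicit Types (A B : set 'rV[R]_m) (f g : R -> set 'rV[R]_m).

(* The library norm on 'rV[R]_m is the max norm, hence this definition. The
   library topology is the product one, i.e. the Euclidean one. *)
Definition eucl_norm (v : 'rV[R]_m) : R := Num.sqrt (\sum_(i < m) v 0 i ^+ 2).

Definition eucl_dist_set (a : 'rV[R]_m) B : \bar R :=
  ereal_inf [set (eucl_norm (a - b))%:E | b in B].

Definition hausdorff_dist A B : \bar R :=
  Order.max (ereal_sup [set eucl_dist_set a B | a in A])
            (ereal_sup [set eucl_dist_set b A | b in B]).

Definition set_norm A : \bar R := hausdorff_dist A [set 0].

Definition compact_valued f : Prop := forall x, f x !=set0 /\ compact (f x).

(* Weak measurability of a multifunction; for compact values it agrees with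
   measurability of f as a map into the Hausdorff metric space. *)
Definition sv_measurable f : Prop :=
  forall U : set 'rV[R]_m, open U ->
    measurable ([set x | f x `&` U !=set0] : set (lebR R)).

Definition L1A f : Prop :=
  [/\ compact_valued f, sv_measurable f,
      (forall x, f (x + pi *+ 2) = f x) &
      (leb R).-integrable (@period R) (fun x => set_norm (f x))].

(* set_norm (f x) is finite because f x is nonempty and compact. *)
Definition LpA (p : \bar R) f : Prop :=
  L1A f /\ Lp p (fun x => fine (set_norm (f x))).

Definition dist_LpA (p : \bar R) f g : \bar R :=
  Lp_norm p (fun x => hausdorff_dist (f x) (g x)).

Definition Phi (p : \bar R) : set (R -> set 'rV[R]_m) :=
  [set f | LpA p f /\ (dist_LpA p f (fun=> [set 0%R]) <= 1)%E].

Definition vec_integrable (phi : R -> 'rV[R]_m) : Prop :=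
  forall i, (leb R).-integrable (@period R) (fun x => (phi x 0 i)%:E).

Definition vec_integral (phi : R -> 'rV[R]_m) : 'rV[R]_m :=
  \row_(i < m) Rintegral (leb R) (@period R) (fun x => phi x 0 i).

Definition aumann_integral f : set 'rV[R]_m :=
  [set vec_integral phi | phi in
    [set phi : R -> 'rV[R]_m | vec_integrable phi /\
       {ae leb R, forall x : lebR R, period x -> f x (phi x)}]].

Definition sv_conv (K : R -> R) g : R -> set 'rV[R]_m :=
  fun x => aumann_integral (fun t => [set K (x - t) *: v | v in g t]).

End SetValued.

(* T ranges over the scalar polynomials and is chosen before g: g |-> T * g is
   one approximation method for the whole class K * Phi p. *)
Definition convolution_deviation (R : realType) (m n : nat) (p : \bar R)
    (K : R -> R) : \bar R :=
  ereal_inf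
    [set ereal_sup [set dist_LpA +oo%E (sv_conv K g) (sv_conv T g)
                   | g in @Phi R m p]
    | T in trig_poly n].

(* Main.v *)
Require Import Defs.
From mathcomp Require Import all_boot all_order all_algebra.
From mathcomp Require Import all_classical all_reals all_analysis.
From mathcomp Require Import measurable_realfun ess_sup_inf ring lra.

(** The two infima run over the same trigonometric polynomials T, and they agree
    term by term: for every T, the supremum over g in Phi p of the distance
    between K * g and T * g is exactly the Lq norm of K - T.

    Upper estimate ([dist_sv_conv_le]). A point of K * g (x) is the integral of
    K (x - t) phi t for a measurable selection phi of g; the same phi gives a
    point of T * g (x), and by Hoelder's inequality their distance is at most
    the Lq norm of K - T times the Lp norm of g. Where K (x - t) = 0 the point
    of K * g (x) does not determine phi, so one needs a measurable selection of
    g; [measurable_selection] takes the lexicographic minimum of each compact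
    value. Reflection and periodicity invariance of Lebesgue measure
    ([leb_period_refl]) make the norm of t |-> (K - T) (x - t) over one period
    independent of x.

    Lower estimate ([dist_sv_conv_ge]). For single-valued g = {phi e}, e a unit
    vector, both convolutions are points and their distance is the modulus of
    the scalar convolution (K - T) * phi. The duality of Lp and Lq
    ([dual_extremal]) provides a bounded phi in the unit ball of Lp for which
    the value of this convolution at 0 comes arbitrarily close to the norm of
    K - T. As phi is bounded and translations are continuous in L1
    ([translation_continuous]), the convolution stays close to that value on
    an interval, which an essential supremum cannot ignore. This covers all
    exponents at once, including q = +oo, where translations are not
    continuous in Lq. *)

Set Implicit Arguments.
Unset Strict Implicit.
Unset Printing Implicit Defensive.

Import Order.TTheory GRing.Theory Num.Theory.
Import numFieldNormedType.Exports.

Local Open Scope classical_set_scope.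
Local Open Scope ring_scope.

(** The image measure as a bundled measure: the instance depends on the proof
    of measurability of the map, which has to be supplied. *)
Notation pushforward_measure :=
  measure_function_pushforward__canonical__measure_function_Measure (only parsing).

(** * Reflections and translations of Lebesgue measure *)

Section LebesgueInvariance.
Context {R : realType}.
Local Notation mu := (leb R).
Implicit Types (A : set (lebR R)) (x y : R).

Lemma borel_lebR (A : set (measurableTypeR R)) :
  measurable A -> measurable (A : set (lebR R)).
Proof. exact: sub_caratheodory. Qed.

Lemma leb_borel (A : set (measurableTypeR R)) :
  mu (A : set (lebR R)) = lebesgue_measure A.
Proof. by []. Qed.

Lemma leb_itv (i : interval R) : mu [set` i] =
  (if (i.1 < i.2)%E then (i.2 - i.1)%E else 0%E).
Proof. exact: lebesgue_measure_itv. Qed.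

(** Transport device: what is known for Borel sets and for null sets passes to
    all Lebesgue measurable sets. *)
Lemma lebR_borel_decomp A : measurable A ->
  exists B N : set (measurableTypeR R), [/\ measurable B, B `<=` A,
    A `\` B `<=` N, measurable N & lebesgue_measure N = 0%E].
Proof.
move=> mA.
have : measurable_realfun.completed_algebra_gen (@lebesgue_measure R) A.
  by rewrite -g_sigma_completed_algebra_genE completed_caratheodory_measurable.
move=> [/= B mB [M [N [/= mN N0 MN]] <-]].
exists B, N; split => //.
by move=> t [[]// Mt _]; exact: MN.
Qed.

Lemma borel_refl x : measurable_fun [set: measurableTypeR R]
  ((fun t : R => x - t) : measurableTypeR R -> measurableTypeR R).
Proof.
apply: measurable_funB; first exact: measurable_cst.
exact: measurable_id.
Qed.

(** By uniqueness of Lebesgue measure it suffices to look at intervals. *)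
Lemma lebesgue_refl x (A : set (measurableTypeR R)) : measurable A ->
  lebesgue_measure ((fun t => x - t) @^-1` A) = lebesgue_measure A.
Proof.
move=> mA.
apply/esym.
apply: (@lebesgue_measure_unique R (pushforward_measure (@lebesgue_measure R)
  (borel_refl x))) => //= _ [[a b]] _ <-.
rewrite /pushforward /=.
have -> : (fun t => x - t) @^-1` `]a, b] = `[x - b, x - a[%classic.
  by apply/seteqP; split => t /=; rewrite !in_itv/= => /andP[? ?]; apply/andP; split; lra.
rewrite !lebesgue_measure_itv/= !lte_fin -!EFinB ltrD2l ltrN2.
by case: ifP => // _; congr EFin; ring.
Qed.

Lemma measurable_lebR_refl x : measurable_fun [set: lebR R]
  ((fun t : R => x - t) : lebR R -> lebR R).
Proof.
move=> _ A mA; rewrite setTI.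
have [B [N [mB BA ABN mN N0]]] := lebR_borel_decomp mA.
have -> : (fun t => x - t) @^-1` A = (fun t => x - t) @^-1` B `|`
    ((fun t => x - t) @^-1` (A `\` B) : set (lebR R)).
  by rewrite -preimage_setU setDUK.
have mp := borel_refl x.
apply: measurableU.
  apply: borel_lebR; rewrite -[X in measurable X]setTI; exact: mp.
apply: negligible_sub_caratheodory.
exists ((fun t => x - t) @^-1` N); split.
- apply: borel_lebR; rewrite -[X in measurable X]setTI; exact: mp.
- by have := lebesgue_refl x mN; rewrite N0.
- by move=> t; apply: ABN.
Qed.

(** Approximating A from inside by a Borel set shows that reflection does not
    decrease the measure; applied to the reflected set, the same inequality
    gives the converse, because a reflection is an involution. *)
Lemma leb_refl x A : measurable A -> mu ((fun t => x - t) @^-1` A) = mu A.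
Proof.
move=> mA.
have key (C : set (lebR R)) y : measurable C -> (mu C <= mu ((fun t => (y - t)%R) @^-1` C))%E.
  move=> mC; have [B [N [mB BA ABN mN N0]]] := lebR_borel_decomp mC.
  apply: (@le_trans _ _ (mu B)); last first.
    rewrite leb_borel -(lebesgue_refl y mB) -leb_borel.
    apply: le_measure; rewrite ?inE.
    - rewrite -[X in measurable X]setTI.
      by apply: (@measurable_lebR_refl y) => //; exact: borel_lebR.
    - by rewrite -[X in measurable X]setTI; apply: (@measurable_lebR_refl y).
    - by move=> t; apply: BA.
  rewrite -[in leLHS](setDUK BA).
  apply: le_trans (measureU2 _ _ _) _.
  - exact: borel_lebR.
  - by apply: measurableD => //; exact: borel_lebR.
  rewrite -[leRHS]adde0 leeD2l// -N0 -leb_borel.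
  apply: le_measure => //; rewrite inE; last exact: borel_lebR.
  by apply: measurableD => //; exact: borel_lebR.
apply/eqP; rewrite eq_le; apply/andP; split; last exact: key.
have mA' : measurable ((fun t => x - t) @^-1` A : set (lebR R)).
  by rewrite -[X in measurable X]setTI; apply: (@measurable_lebR_refl x).
apply: (le_trans (key _ x mA')).
rewrite -comp_preimage (_ : _ \o _ = id) ?preimage_id//.
by apply/funext => t /=; lra.
Qed.

(** A translation is the composite of two reflections. *)
Lemma leb_shift c A : measurable A -> mu ((fun t => t + c) @^-1` A) = mu A.
Proof.
move=> mA; rewrite -[RHS](leb_refl 0 mA).
have mA' : measurable ((fun t => 0 - t) @^-1` A : set (lebR R)).
  by rewrite -[X in measurable X]setTI; apply: (@measurable_lebR_refl 0).
rewrite -(leb_refl (- c) mA') -comp_preimage; congr (mu (_ @^-1` A)).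
by apply/funext => t /=; lra.
Qed.

Lemma measurable_lebR_itv (i : interval R) :
  measurable ([set` i] : set (lebR R)).
Proof. by apply: borel_lebR; exact: measurable_itv. Qed.

Lemma measurable_period : measurable (@period R).
Proof. exact: measurable_lebR_itv. Qed.

Lemma leb_period : mu (@period R) = (pi *+ 2)%:E.
Proof.
by rewrite /period leb_itv /= lte_fin mulrn_wgt0 ?pi_gt0// oppr0 adde0.
Qed.

Section Periodic.
Variable A : set (lebR R).
Hypothesis mA : measurable A.
Local Notation P := (pi *+ 2 : R).
Hypothesis pA : forall t, A (t + P) <-> A t.

Let G a := mu (`[a, a + P[ `&` A).

Let G_step a b : a <= b -> b <= a + P -> G a = G b.
Proof.
move=> ab baP.
have mI u v : measurable (`[u, v[ `&` A : set (lebR R)).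
  by apply: measurableI => //; exact: measurable_lebR_itv.
have split_itv u v w : u <= v -> v <= w ->
    mu (`[u, w[ `&` A) = (mu (`[u, v[ `&` A) + mu (`[v, w[ `&` A))%E.
  move=> uv vw; rewrite -measureU//; last first.
    apply/seteqP; split => // t /= [[]]; rewrite !in_itv/=.
    by move=> /andP[_ tv] _ [/andP[vt _] _]; move: (lt_le_trans tv vt); rewrite ltxx.
  congr (mu _); rewrite -setIUl; congr (_ `&` _).
  apply/seteqP; split => t /=; rewrite !in_itv/=.
    move=> /andP[ut tw]; case: (ltP t v) => tv; [left|right]; exact/andP.
  by move=> [] /andP[? ?]; apply/andP; split; lra.
rewrite /G (split_itv a b)// [RHS](split_itv b (a + P)) ?lerD2r//.
rewrite addeC; congr (_ + _)%E.
rewrite -(leb_shift P (mI (a + P) (b + P))); congr (mu _).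
apply/seteqP; split => t /=; rewrite !in_itv/=.
  by move=> [/andP[? ?] ?]; split; [apply/andP; split; lra|exact/pA].
by move=> [/andP[? ?] /pA ?]; split => //; apply/andP; split; lra.
Qed.

Let G_cst a b : G a = G b.
Proof.
wlog ab : a b / a <= b => [wl|].
  by have [/wl//|/ltW/wl->] := leP a b.
have P0 : 0 < P by rewrite mulrn_wgt0 ?pi_gt0.
have [n bn] : exists n, b <= a + P * n%:R.
  exists (Num.truncn ((b - a) / P)).+1.
  rewrite -lerBlDl mulrC -ler_pdivrMr// ltW//.
  exact: truncnS_gt.
elim: n b ab bn => [b ab|n ih b ab bn].
  by rewrite mulr0 addr0 => ba; congr G; apply/eqP; rewrite eq_le ab ba.
have [ban|ban] := leP b (a + P * n%:R); first exact: ih.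
have an : a <= a + P * n%:R by rewrite lerDl mulr_ge0// ltW.
rewrite (ih (a + P * n%:R))//; apply: G_step; first exact: ltW.
by move: bn; rewrite -natr1 mulrDr mulr1 addrA.
Qed.

Let closed_itv u v : mu (`[u, v] `&` A) = mu (`[u, v[ `&` A).
Proof.
apply/eqP; rewrite eq_le; apply/andP; split; last first.
  apply: le_measure; rewrite ?inE; [apply: measurableI => //;
    exact: measurable_lebR_itv..|].
  by move=> t /=; rewrite !in_itv/= => -[/andP[-> /ltW->]].
have mI : measurable (`[u, v[ `&` A : set (lebR R)).
  by apply: measurableI => //; exact: measurable_lebR_itv.
have mv : measurable (`[v, v] : set (lebR R)) by exact: measurable_lebR_itv.
have -> : mu (`[u, v[ `&` A) = (mu (`[u, v[ `&` A) + mu `[v, v]%classic)%E.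
  by rewrite leb_itv /= ltxx adde0.
apply: le_trans (measureU2 _ mI mv).
apply: le_measure; rewrite ?inE; [apply: measurableI => //;
    exact: measurable_lebR_itv|exact: measurableU|].
move=> t /=; rewrite !in_itv/= => -[/andP[ut tv] At].
have [tv'|tv'] := ltP t v; [left|right]; first by rewrite ut.
by rewrite tv.
Qed.

(** Every convolution integral is brought back to the fundamental period with
    this lemma. The mass of a periodic set in a window [a, a + 2 pi[ does not
    depend on a: moving the window to b removes [a, b[ and adds its translate by
    one period. *)
Lemma leb_period_refl x :
  mu (@period R `&` (fun t => x - t) @^-1` A) = mu (@period R `&` A).
Proof.
have -> : @period R `&` (fun t => x - t) @^-1` A =
    (fun t => x - t) @^-1` (`[x - P, x] `&` A).
  apply/seteqP; split => t /=; rewrite /period/= !in_itv/=;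
    by move=> [/andP[? ?] ?]; split => //; apply/andP; split; lra.
rewrite leb_refl; last by apply: measurableI => //; exact: measurable_lebR_itv.
rewrite /period !closed_itv.
have := G_cst (x - P) 0; rewrite /G subrK add0r; exact.
Qed.

End Periodic.

End LebesgueInvariance.

(** * Norms over one period *)

Section LawInvariance.
Context d {T : measurableType d} {R : realType}.
Variables (mu : {measure set T -> \bar R}) (D : set T) (mD : measurable D).

(** The integral of F o u over D depends only on the law of u restricted to D.
    To obtain it from the transfer theorem on the whole space, u is sent to +oo
    outside D, and one integrates F over the finite values. *)
Lemma ge0_integral_law (u v : T -> R) (F : R -> \bar R) :
  measurable_fun setT u -> measurable_fun setT v ->
  (forall B : set R, measurable B ->
     mu (D `&` u @^-1` B) = mu (D `&` v @^-1` B)) ->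
  measurable_fun setT F -> (forall y, 0 <= F y)%E ->
  (\int[mu]_(x in D) F (u x) = \int[mu]_(x in D) F (v x))%E.
Proof.
move=> mu_ mv law mF F0.
pose ext (w : T -> R) x := if x \in D then (w x)%:E else +oo%E.
have mext w : measurable_fun setT w -> measurable_fun setT (ext w).
  move=> mw; apply: measurable_fun_ifT => //.
  - by apply: (measurable_fun_bool true); rewrite setTI preimage_mem_true.
  - exact/measurable_EFinP.
have preim w (A : set (\bar R)) : ~ A +oo%E ->
    ext w @^-1` A = D `&` w @^-1` (EFin @^-1` A).
  move=> Ay; apply/seteqP; split => x /=; rewrite /ext.
    by case: ifPn => // /set_mem.
  by move=> [Dx]; rewrite mem_set.
have key w : measurable_fun setT w ->
    (\int[mu]_(x in D) F (w x) =
     \int[pushforward mu (ext w)]_(y in ~` [set +oo]) F (fine y))%E.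
  move=> mw; rewrite (ge0_integral_pushforward (mext _ mw))//; last first.
  - by apply: measurable_funTS; apply: measurableT_comp => //; exact: fine_measurable.
  - exact: measurableC.
  rewrite preim; last by apply.
  have -> : D `&` w @^-1` (EFin @^-1` (~` [set +oo%E])) = D.
    by apply/seteqP; split => [x []|x Dx]//; split.
  by apply: eq_integral => x Dx /=; rewrite /ext Dx.
rewrite !key//.
have mem w A : measurable_fun setT w -> measurable (A : set (\bar R)) ->
  measurable (ext w @^-1` A).
  by move=> mw mA; rewrite -[X in measurable X]setTI; exact: mext.
apply: (@eq_measure_integral _ _ _ _
  (pushforward_measure mu (mext _ mv))
  (pushforward_measure mu (mext _ mu_))).
move=> A mA Ay; change (mu (ext u @^-1` A) = mu (ext v @^-1` A)).
rewrite !preim; [|by move=> /Ay; apply..].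
apply: law; rewrite -[X in measurable X]setTI.
exact: EFin_measurable.
Qed.

End LawInvariance.

Section PeriodNorm.
Context {R : realType}.
Local Notation mu := (leb R).
Local Notation D := (@period R).
Local Notation P := (pi *+ 2 : R).
Implicit Types (f g : R -> R) (p q : \bar R).

Local Notation meas f := (measurable_fun [set: lebR R] (f : lebR R -> R)).

Lemma leb_setT_gt0 : (0 < mu setT)%E.
Proof.
apply: (@lt_le_trans _ _ (mu D)).
  by rewrite leb_period lte_fin mulrn_wgt0 ?pi_gt0.
by apply: le_measure; rewrite ?inE//; exact: measurable_period.
Qed.

Lemma measurable_comp_refl f x : meas f -> meas (fun t => f (x - t)).
Proof.
by move=> mf; apply: (measurableT_comp mf); exact: measurable_lebR_refl.
Qed.

Lemma period_law_refl f x (B : set R) : meas f -> periodic f P -> measurable B ->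
  mu (D `&` (fun t => f (x - t)) @^-1` B) = mu (D `&` f @^-1` B).
Proof.
move=> mf pf mB.
apply: (leb_period_refl (A := f @^-1` B)).
  by rewrite -[X in measurable X]setTI; exact: mf.
by move=> t; rewrite /= pf.
Qed.

Lemma ge0_integral_period_refl f (F : R -> \bar R) x :
  meas f -> periodic f P -> measurable_fun setT F -> (forall y, 0 <= F y)%E ->
  (\int[mu]_(t in D) F (f (x - t)%R) = \int[mu]_(t in D) F (f t))%E.
Proof.
move=> mf pf mF F0.
apply: (@ge0_integral_law _ _ _ mu D measurable_period
  ((fun t => f (x - t)) : lebR R -> R) f F _ mf _ mF F0).
  exact: measurable_comp_refl.
by move=> B mB; exact: period_law_refl.
Qed.

Lemma Lp_norm_fin (r : R) f : 0 < r -> Lp_norm r%:E (EFin \o f) =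
  ((\int[mu]_(t in D) (`|f t| `^ r)%:E) `^ r^-1)%E.
Proof.
move=> r0; rewrite /Lp_norm unlock/=; congr (_ `^ _)%E.
rewrite [RHS]integral_mkcond; apply: eq_integral => t _.
rewrite /patch; case: ifPn => // _.
by rewrite /= normr0 powR0// gt_eqF.
Qed.

Lemma Lp_norm1 f : Lp_norm 1 (EFin \o f) = (\int[mu]_(t in D) (`|f t|)%:E)%E.
Proof.
rewrite /Lp_norm Lnorm1 [RHS]integral_mkcond; apply: eq_integral => t _.
by rewrite /patch; case: ifPn => // _; rewrite abse0.
Qed.

Lemma Lp_normyP (F : R -> \bar R) (y : \bar R) : (0 <= y)%E ->
  (Lp_norm +oo F <= y)%E <->
  {ae mu, forall t : lebR R, D t -> (`|F t| <= y)%E}.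
Proof.
move=> y0; rewrite /Lp_norm unlock leb_setT_gt0.
split=> [/ess_supP|h].
  by apply: filterS => t /= + Dt; rewrite /patch mem_set.
apply/ess_supP; apply: filterS h => t /= h; rewrite /patch.
by case: ifPn => [/set_mem/h//|_]; rewrite abse0.
Qed.

Lemma Lp_norm_ge0 p (F : R -> \bar R) : (0 <= Lp_norm p F)%E.
Proof. exact: Lnorm_ge0. Qed.

(** For finite q this is the law of f over a period, for q = +oo the measure of
    a level set; both are preserved by reflection. *)
Lemma Lp_norm_refl q f x : (1 <= q)%E -> meas f -> periodic f P ->
  (Lp_norm q (EFin \o (fun t => f (x - t)%R)) <= Lp_norm q (EFin \o f))%E.
Proof.
move=> q1 mf pf; case: q q1 => [r r1||//].
  have r0 : 0 < r by rewrite lee_fin in r1; exact: lt_le_trans r1.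
  rewrite !(Lp_norm_fin _ r0).
  rewrite (@ge0_integral_period_refl f (fun y => (`|y| `^ r)%:E) x mf pf)//.
  apply/measurable_EFinP.
  apply: (measurableT_comp (measurable_powR r)).
  exact: normr_measurable.
move=> _; set M := (leRHS).
have M0 : (0 <= M)%E by exact: Lp_norm_ge0.
have /(Lp_normyP _ M0) h : (Lp_norm +oo (EFin \o f) <= M)%E by [].
apply/(Lp_normyP _ M0).
pose B : set R := [set y | ~ (`|y|%:E <= M)%E].
have mB : measurable B.
  have -> : B = setT `&` [set y : R | (M < `|y|%:E)%E].
    rewrite setTI; apply/seteqP; split => y /=; rewrite /B/= ltNge.
      by move/negP.
    by move/negP.
  apply: (@emeasurable_fun_o_infty _ _ _ _ (fun y : R => `|y|%:E)) => //.
  exact/measurable_EFinP.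
have mDB : measurable (D `&` f @^-1` B : set (lebR R)).
  apply: measurableI; first exact: measurable_period.
  by rewrite -[X in measurable X]setTI; exact: mf.
have mDBx : measurable (D `&` (fun t => f (x - t)) @^-1` B : set (lebR R)).
  apply: measurableI; first exact: measurable_period.
  rewrite -[X in measurable X]setTI.
  by apply: (measurable_comp_refl x mf).
exists (D `&` (fun t => f (x - t)) @^-1` B); split => //.
  rewrite period_law_refl//.
  apply/eqP; rewrite eq_le measure_ge0 andbT.
  case: h => N [mN N0 h]; rewrite -N0; apply: le_measure; rewrite ?inE//.
  move=> t [Dt Bt]; apply: h => /= h; apply: Bt; exact: h.
move=> t /= /not_implyP [Dt]; split => //.
Qed.

Lemma eq_norm_Lp_norm p (u v : R -> R) : (forall t, `|u t| = `|v t|) ->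
  Lp_norm p (EFin \o u) = Lp_norm p (EFin \o v).
Proof.
move=> uv; rewrite /Lp_norm -[LHS]Lnorm_abse -[RHS]Lnorm_abse; congr Lnorm.
apply/funext => t /=; rewrite /patch; case: ifP => //= _.
by rewrite uv.
Qed.

End PeriodNorm.

(** * Conjugate exponents and Hoelder's inequality *)

Section Hoelder.
Context {R : realType}.
Local Notation mu := (leb R).
Local Notation D := (@period R).
Local Notation P := (pi *+ 2 : R).
Implicit Types (f g : R -> R) (p q : \bar R).

Local Notation meas f := (measurable_fun [set: lebR R] (f : lebR R -> R)).

(** The two endpoint cases need separate arguments throughout, hence a case
    analysis that exposes real exponents in the interior case. *)
Variant conjugate_exponents : \bar R -> \bar R -> Prop :=
| ConjOneInfty : conjugate_exponents 1 +oo
| ConjInftyOne : conjugate_exponents +oo 1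
| ConjFinite (a b : R) of 1 < a & 1 < b & a^-1 + b^-1 = 1 :
    conjugate_exponents a%:E b%:E.

Lemma conjugate_exponents_cases p q : (1 <= p)%E -> (1 <= q)%E ->
  (p^-1 + q^-1 = 1)%E -> conjugate_exponents p q.
Proof.
move=> p1 q1.
have [->|qy] := eqVneq q +oo%E.
  move=> /eqP; rewrite invey adde0 inve_eq1 => /eqP ->.
  exact: ConjOneInfty.
have [->|py] := eqVneq p +oo%E.
  move=> /eqP; rewrite invey add0e inve_eq1 => /eqP ->.
  exact: ConjInftyOne.
case: p q p1 q1 py qy => [a||] [b||]//.
rewrite !lee_fin => a1 b1 _ _.
have a0 : 0 < a by exact: lt_le_trans a1.
have b0 : 0 < b by exact: lt_le_trans b1.
rewrite !inver !gt_eqF// -EFinD => -[ab].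
have ai : 0 < a^-1 by rewrite invr_gt0.
have bi : 0 < b^-1 by rewrite invr_gt0.
apply: ConjFinite => //; rewrite -invf_lt1//; lra.
Qed.

(** Finiteness of the norms rules out products of the form 0 * +oo. *)
Lemma hoelder_period p q f g : (1 <= p)%E -> (1 <= q)%E ->
  (p^-1 + q^-1 = 1)%E -> meas f -> meas g ->
  (Lp_norm q (EFin \o f) < +oo)%E -> (Lp_norm p (EFin \o g) < +oo)%E ->
  (\int[mu]_(t in D) (`|f t * g t|)%:E <=
   Lp_norm q (EFin \o f) * Lp_norm p (EFin \o g))%E.
Proof.
move=> p1 q1 pq mf mg.
have sup1 u v : meas u -> meas v -> (Lp_norm +oo (EFin \o u) < +oo)%E ->
    (\int[mu]_(t in D) (`|u t * v t|)%:E <=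
   Lp_norm +oo (EFin \o u) * Lp_norm 1 (EFin \o v))%E.
  have mD := @measurable_period R.
  move=> mU mv uoo; have u0 := Lp_norm_ge0 +oo (EFin \o u).
  have ufin : Lp_norm +oo (EFin \o u) \is a fin_num by rewrite ge0_fin_numE.
  have mE w : meas w -> measurable_fun D (fun t => (`|w t|)%:E).
    move=> mw; apply: measurable_funTS; apply/measurable_EFinP.
    by apply: measurableT_comp; first exact: normr_measurable.
  have v0 t : D t -> (0 <= (`|v t|)%:E)%E by rewrite lee_fin.
  rewrite Lp_norm1 -(fineK ufin).
  rewrite -(ge0_integralZl_EFin mu mD v0 (mE v mv) (fine_ge0 u0)).
  apply: (ae_ge0_le_integral mD).
  - by move=> t _; rewrite lee_fin.
  - by apply: (mE (fun t => u t * v t)); exact: measurable_funM.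
  - by move=> t _; rewrite -EFinM lee_fin mulr_ge0// fine_ge0.
  - by apply: measurable_funeM; exact: mE.
  have /(Lp_normyP _ u0) : (Lp_norm +oo (EFin \o u) <= Lp_norm +oo (EFin \o u))%E by [].
  apply: filterS => t h /h; rewrite -(fineK ufin) /= !lee_fin normrM => ht.
  by rewrite ler_wpM2r.
case: (conjugate_exponents_cases p1 q1 pq) => [||a b a1 b1 ab] foo goo.
- exact: sup1.
- under eq_integral do rewrite mulrC.
  by rewrite muleC; exact: sup1.
have a0 : 0 < a by exact: lt_trans a1.
have b0 : 0 < b by exact: lt_trans b1.
have mr u : meas u -> meas (u \_ D).
  move=> mU; apply/(@measurable_restrictT _ _ _ _ D) => //; first exact: measurable_period.
  exact: measurable_funTS.
have := @hoelder _ _ _ mu (f \_ D) (g \_ D) b a (mr _ mf) (mr _ mg) b0 a0.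
rewrite addrC => /(_ ab).
rewrite /Lp_norm !restrict_EFin; apply: le_trans.
rewrite Lnorm1 [leLHS]integral_mkcond le_eqVlt; apply/orP; left; apply/eqP.
apply: eq_integral => t _; rewrite /= /patch; case: ifP => //.
by rewrite mulr0 normr0.
Qed.

Lemma Lp_norm_bounded p f (M : R) : (1 <= p)%E -> meas f ->
  (forall t, `|f t| <= M) -> (Lp_norm p (EFin \o f) < +oo)%E.
Proof.
move=> p1 mf fM; have M0 : 0 <= M by apply: le_trans (fM 0).
case: p p1 => [a||//]; last first.
  move=> _; apply: (@le_lt_trans _ _ M%:E); last exact: ltry.
  by apply/Lp_normyP; [rewrite lee_fin|apply: aeW => t _ /=; rewrite lee_fin].
rewrite lee_fin => a1; have a0 : 0 < a by exact: lt_le_trans a1.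
rewrite Lp_norm_fin// poweR_lty//.
apply: (@le_lt_trans _ _ (\int[mu]_(t in D) (M `^ a)%:E)%E).
  apply: (@ge0_le_integral _ _ _ mu D (@measurable_period R)).
  - by move=> t _; rewrite lee_fin powR_ge0.
  - apply/measurable_EFinP; apply: measurable_funTS.
    apply: (measurableT_comp (measurable_powR a)).
    by apply: measurableT_comp; first exact: normr_measurable.
  - exact: measurable_cst.
  - by move=> t _; rewrite lee_fin ge0_ler_powR ?nnegrE// ltW.
rewrite integral_cst; last exact: measurable_period.
by rewrite leb_period -EFinM ltry.
Qed.

Lemma Lp_integrable p q f : (1 <= p)%E -> (1 <= q)%E -> (p^-1 + q^-1 = 1)%E ->
  meas f -> (Lp_norm q (EFin \o f) < +oo)%E ->
  mu.-integrable D (EFin \o f).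
Proof.
move=> p1 q1 pq mf foo; apply/integrableP; split.
  by apply/measurable_EFinP; exact: measurable_funTS.
have m1 : meas (fun=> 1 : R) by exact: measurable_cst.
have oo1 : (Lp_norm p (EFin \o (fun=> 1%R : R)) < +oo)%E.
  by apply: (@Lp_norm_bounded _ _ 1) => // t; rewrite normr1.
apply: le_lt_trans (le_trans _ (hoelder_period p1 q1 pq mf m1 foo oo1)) _.
  apply: (@ge0_le_integral _ _ _ mu D (@measurable_period R)).
  - by move=> t _; exact: abse_ge0.
  - apply/measurable_EFinP; apply: measurable_funTS.
    by apply: measurableT_comp; first exact: normr_measurable.
  - apply/measurable_EFinP; apply: measurable_funTS.
    apply: measurableT_comp; first exact: normr_measurable.
    by apply: measurable_funM.
  - by move=> t _ /=; rewrite mulr1.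
by rewrite lte_mul_pinfty ?Lp_norm_ge0// ge0_fin_numE ?Lp_norm_ge0.
Qed.

Lemma Lp_normB_lty q f g : (1 <= q)%E -> meas f -> meas g ->
  (Lp_norm q (EFin \o f) < +oo)%E -> (Lp_norm q (EFin \o g) < +oo)%E ->
  (Lp_norm q (EFin \o (fun t => f t - g t)%R) < +oo)%E.
Proof.
move=> q1 mf mg foo goo.
have mr u : meas u -> meas (u \_ D).
  move=> mU; apply/(@measurable_restrictT _ _ _ _ D) => //; first exact: measurable_period.
  exact: measurable_funTS.
have mNg : meas (fun t => - g t) by exact: measurableT_comp.
have := @eminkowski _ _ _ mu (f \_ D) ((fun t => - g t) \_ D) q (mr _ mf) (mr _ mNg) q1.
rewrite -!restrict_EFin -/(Lp_norm q (EFin \o f)).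
rewrite -/(Lp_norm q (EFin \o (fun t => - g t))).
rewrite (@eq_norm_Lp_norm R q (fun t => - g t) g); last first.
  by move=> t; rewrite normrN.
move=> h; apply: le_lt_trans (le_trans _ h) _; last exact: lte_add_pinfty.
rewrite /Lp_norm le_eqVlt; apply/orP; left; apply/eqP; congr Lnorm.
apply/funext => t; rewrite /= /patch /=; case: ifP => //.
by rewrite addr0.
Qed.

End Hoelder.

(** * Trigonometric polynomials *)

Section TrigPoly.
Context {R : realType}.
Variables (n : nat) (T : R -> R).
Hypothesis tT : trig_poly n T.

Lemma trig_poly_periodic : periodic T (pi *+ 2).
Proof.
case: tT => a [b Tab] x; rewrite !Tab; congr (_ + _).
apply: eq_bigr => k _.
have -> : k%:R * (x + pi *+ 2) = k%:R * x + (pi *+ 2) *+ k.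
  by rewrite mulrDr; congr (_ + _); rewrite mulr_natl.
by rewrite (periodicn (@cosD2pi R)) (periodicn (@sinD2pi R)).
Qed.

Lemma trig_poly_bounded : exists M, forall x, `|T x| <= M.
Proof.
case: tT => a [b Tab].
exists (`|a 0%N / 2| + \sum_(1 <= k < n) (`|a k| + `|b k|)) => x; rewrite Tab.
apply: le_trans (ler_normD _ _) _; rewrite lerD2l.
apply: le_trans (ler_norm_sum _ _ _) _; apply: ler_sum => k _.
apply: le_trans (ler_normD _ _) _; rewrite !normrM.
by apply: lerD; rewrite ler_piMr// ler_norml ?cos_le1 ?cos_geN1 ?sin_le1 ?sin_geN1.
Qed.

Lemma trig_poly_continuous : continuous T.
Proof.
case: tT => a [b Tab].
have -> : T = (fun x => a 0%N / 2 +
    \sum_(1 <= k < n) (a k * cos (k%:R * x) + b k * sin (k%:R * x))).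
  exact/funext.
move=> x; apply: cvgD; first exact: cvg_cst.
apply: cvg_big => [|k _]; first exact: add_continuous.
have ck : {for x, continuous (fun y : R => k%:R * y)} by exact: mulrl_continuous.
apply: cvgD; apply: cvgM; try exact: cvg_cst.
  by apply: (continuous_comp ck); exact: continuous_cos.
by apply: (continuous_comp ck); exact: continuous_sin.
Qed.

End TrigPoly.

Section LebesgueMeasurable.
Context {R : realType}.

Lemma borel_fun_lebR d (T : sigmaRingType d) (f : R -> T) :
  measurable_fun [set: measurableTypeR R] f ->
  measurable_fun [set: lebR R] (f : lebR R -> T).
Proof.
move=> mf _ B mB; rewrite setTI; apply: borel_lebR.
by rewrite -[X in measurable X]setTI; exact: mf.
Qed.

Lemma trig_poly_measurable n (T : R -> R) : trig_poly n T ->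
  measurable_fun [set: lebR R] (T : lebR R -> R).
Proof.
move=> tT; apply: borel_fun_lebR; apply: continuous_measurable_fun.
exact: trig_poly_continuous tT.
Qed.

Lemma trig_poly_Lp n q (T : R -> R) : (1 <= q)%E -> trig_poly n T -> Lp q T.
Proof.
move=> q1 tT; split.
- exact: trig_poly_measurable tT.
- exact: trig_poly_periodic tT.
- have [M TM] := trig_poly_bounded tT.
  exact: Lp_norm_bounded q1 (trig_poly_measurable tT) TM.
Qed.

End LebesgueMeasurable.

(** * Measurable selections of compact-valued maps *)

Section Selection.
Context d {T : measurableType d} {R : realType} {m : nat}.
Local Notation V := 'rV[R]_m.
Implicit Types (F : T -> set V) (C : set V) (i : 'I_m) (r : R).

(** Strong measurability of a multifunction. Unlike the weak one, it is stable
    under intersection with the closed half-spaces that occur in the selection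
    argument. *)
Definition closed_measurable_sv F := forall C, closed C ->
  measurable [set x | F x `&` C !=set0].

(** A cluster point of the approximating points lies in the compact set, and at
    distance zero from the closed one. *)
Lemma compact_meets_closed (A : set V) C : compact A -> closed C ->
  (forall k : nat, exists2 v, A v & exists2 c, C c & `|v - c| < k.+1%:R^-1) ->
  A `&` C !=set0.
Proof.
move=> cA cC h.
pose v k := sval (cid2 (h k)).
have vA k : A (v k) by rewrite /v; case: cid2.
have vC k : exists2 c, C c & `|v k - c| < k.+1%:R^-1.
  by rewrite /v; case: cid2.
have vA' : (v @ \oo) A by exists 0 => // k _; exact: vA.
have [p [Ap clp]] := cA (v @ \oo) _ vA'.
exists p; split => //; apply: cC => B /nbhs_ballP[e /= e0 eB].
have e20 : 0 < e / 2 by rewrite divr_gt0.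
have [N _ NP] : \forall k \near \oo, k.+1%:R^-1 < e / 2.
  exact: (near_infty_natSinv_lt (PosNum e20)).
have := clp (v @` [set k | (N <= k)%N]) (ball p (e / 2)).
case.
- by exists N => //= k Nk; exists k.
- exact: nbhsx_ballx.
move=> _ [[k /= Nk <-] pk].
have [c Cc vc] := vC k; exists c; split => //; apply: eB.
rewrite -ball_normE /=; rewrite -ball_normE /= in pk.
rewrite -(subrK (v k) p) -addrA (le_lt_trans (ler_normD _ _))// [e]splitr.
by rewrite ltrD// (lt_trans vc)// NP.
Qed.

(** A compact set meets a closed set as soon as it meets all its open
    neighbourhoods of radius 1/(k+1). *)
Lemma closed_measurable_sv_compact F :
  (forall x, compact (F x)) ->
  (forall U, open U -> measurable [set x | F x `&` U !=set0]) ->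
  closed_measurable_sv F.
Proof.
move=> cF mF C cC.
pose U k : set V := \bigcup_(c in C) ball c k.+1%:R^-1.
have oU k : open (U k).
  by apply: bigcup_open => c _; apply: ball_open; rewrite invr_gt0.
have -> : [set x | F x `&` C !=set0] =
    \bigcap_k [set x | F x `&` U k !=set0].
  apply/seteqP; split => x /=.
    move=> [c [Fc Cc]] k _; exists c; split => //; exists c => //.
    by apply: ballxx; rewrite invr_gt0.
  move=> h; apply: compact_meets_closed => // k.
  have [v [Fv [c Cc]]] := h k I; rewrite -ball_normE /= => cv.
  by exists v => //; exists c => //; rewrite distrC.
by apply: bigcapT_measurable => k; exact: mF.
Qed.

(** One step of the lexicographic minimum: the subset of F x on which the i-th
    coordinate is minimal is again compact and strongly measurable, and the
    minimal value is a measurable function of x. This subset misses C exactly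
    when some rational s >= c x separates: F x has no point in C with i-th
    coordinate at most s. *)
Lemma coord_min_face F i : (forall x, F x !=set0 /\ compact (F x)) ->
  closed_measurable_sv F ->
  exists c : T -> R, measurable_fun setT c /\
    let F' := fun x => F x `&` [set v | v 0 i = c x] in
    (forall x, F' x !=set0 /\ compact (F' x)) /\ closed_measurable_sv F'.
Proof.
move=> F0 mF.
have min x C : closed C -> F x `&` C !=set0 ->
    exists2 v, (F x `&` C) v & forall w, (F x `&` C) w -> v 0 i <= w 0 i.
  move=> cC FC0.
  have [] := @compact_EVT_min V R (fun v : V => v 0 i) (F x `&` C) FC0.
  - by apply: compact_closedI => //; exact: (F0 x).2.
  - by apply: continuous_subspaceT; exact: coord_continuous.
  - move=> v /set_mem vFC vmin; exists v => // w wFC.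
    by apply: vmin; exact: mem_set.
have FT x : F x `&` setT !=set0 by rewrite setIT; exact: (F0 x).1.
pose c x := sval (cid2 (min x setT closedT (FT x))) 0 i.
have cP x : (exists2 v, F x v & v 0 i = c x) /\ forall w, F x w -> c x <= w 0 i.
  rewrite /c; case: cid2 => v /= [Fv _] vmin; split; first by exists v.
  by move=> w Fw; exact: vmin.
have ccl (A : set R) : closed A -> closed [set v : V | A (v 0 i)].
  move=> cA; apply: (@preimage_closed _ _ (fun v : V => v 0 i)) => //.
  by move=> v _; exact: coord_continuous.
have cler r : closed [set v : V | v 0 i <= r].
  by apply: (ccl [set s | s <= r]); exact: closed_le.
have mc r : measurable [set x | c x <= r].
  rewrite (_ : [set x | _] = [set x | F x `&` [set v : V | v 0 i <= r] !=set0]).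
    exact: mF.
  apply/seteqP; split => x /=; have [[v Fv vc] cmin] := cP x.
    by move=> cr; exists v; split => //=; rewrite vc.
  by move=> [w [Fw /= wr]]; apply: le_trans wr; exact: cmin.
exists c; split; [|split].
- move=> mT; apply: (measurability _ (RGenOInfty.measurableE R)) => //.
  move=> _ [_ [r ->] <-]; rewrite setTI.
  rewrite (_ : _ @^-1` _ = ~` [set x | c x <= r]); first exact: measurableC.
  by apply/seteqP; split => x /=; rewrite in_itv/= andbT ltNge => /negP.
- move=> x; split.
    by have [[v Fv vc] _] := cP x; exists v.
  apply: compact_closedI; first exact: (F0 x).2.
  by apply: (ccl [set s | s = c x]); exact: closed_eq.
move=> C cC.
pose Q (s : rat) := [set x | c x <= ratr s] `\`
  [set x | F x `&` (C `&` [set v : V | v 0 i <= ratr s]) !=set0].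
rewrite (_ : [set x | _] = ~` \bigcup_s Q s).
  apply: measurableC; apply: bigcupT_measurable_rat => s.
  by apply: measurableD; [exact: mc|apply: mF; exact: closedI].
apply/seteqP; split => x /=.
  move=> [v [[Fv /= vc] Cv]] [s _ [/= cs]]; apply.
  by exists v; split => //; split => //=; rewrite vc.
move=> nQ; apply: contrapT => h; apply: nQ.
have [FC|FC] := pselect (F x `&` C !=set0).
  have [v [Fv Cv] vmin] := min x C cC FC.
  have cv : c x < v 0 i.
    rewrite lt_neqAle (cP x).2// andbT; apply/negP => /eqP cv.
    by apply: h; exists v.
  have [s] := rat_in_itvoo cv; rewrite in_itv/= => /andP[cs sv].
  exists s => //; split; first exact: ltW.
  move=> [w [Fw [Cw /= ws]]].
  by have := lt_le_trans sv (vmin w (conj Fw Cw)); rewrite ltNge ws.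
have cx1 : c x < c x + 1 by rewrite ltrDl.
have [s] := rat_in_itvoo cx1; rewrite in_itv/= => /andP[cs _].
exists s => //; split; first exact: ltW.
by move=> [w [Fw [Cw _]]]; apply: FC; exists w.
Qed.

(** Minimising the coordinates one after the other leaves a single point, whose
    coordinates are the successive minimal values and therefore measurable. *)
Lemma measurable_selection F : (forall x, F x !=set0 /\ compact (F x)) ->
  (forall U, open U -> measurable [set x | F x `&` U !=set0]) ->
  exists phi : T -> V, (forall x, F x (phi x)) /\
    forall i, measurable_fun setT (fun x => phi x 0 i).
Proof.
move=> F0 /closed_measurable_sv_compact mF.
have {}mF : closed_measurable_sv F by apply: mF => x; exact: (F0 x).2.
have [G [GF [G0 _] Gc]] : exists G : T -> set V, [/\ forall x, G x `<=` F x,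
    (forall x, G x !=set0 /\ compact (G x)) /\ closed_measurable_sv G &
    forall i, i \in enum 'I_m -> exists2 c : T -> R, measurable_fun setT c &
      forall x v, G x v -> v 0 i = c x].
  elim: (enum 'I_m) => [|i s [G [GF [G0 mG] Gc]]]; first by exists F; split => // x v.
  have [c [mc [G'0 mG']]] := coord_min_face i G0 mG.
  exists (fun x => G x `&` [set v | v 0 i = c x]); split => //.
    by move=> x v [/GF].
  move=> j; rewrite inE => /predU1P[->|/Gc[c' mc' c'P]].
    by exists c => // x v [].
  by exists c' => // x v [/c'P].
pose phi x := sval (cid (G0 x).1).
have phiG x : G x (phi x) by rewrite /phi; case: cid.
exists phi; split=> [x|i]; first exact: GF.
have [|c mc cP] := Gc i; first by rewrite mem_enum.
by rewrite (_ : (fun x => _) = c)//; apply/funext => x; exact: cP.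
Qed.

End Selection.

(** * Euclidean norm, Hausdorff distance and vector integrals *)

Section EuclideanNorm.
Context {R : realType} {m : nat}.
Local Notation V := 'rV[R]_m.
Implicit Types (u v w : V) (A B : set V).

Lemma sum_sqr_ge0 v : 0 <= \sum_(i < m) v 0 i ^+ 2.
Proof. by apply: sumr_ge0 => i _; exact: sqr_ge0. Qed.

Lemma eucl_norm_ge0 v : 0 <= eucl_norm v.
Proof. exact: sqrtr_ge0. Qed.

Lemma sqr_eucl_norm v : eucl_norm v ^+ 2 = \sum_(i < m) v 0 i ^+ 2.
Proof. by rewrite sqr_sqrtr// sum_sqr_ge0. Qed.

Lemma eucl_normZ (a : R) v : eucl_norm (a *: v) = `|a| * eucl_norm v.
Proof.
rewrite /eucl_norm; under eq_bigr do rewrite mxE exprMn.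
by rewrite -mulr_sumr sqrtrM ?sqr_ge0// sqrtr_sqr.
Qed.

Lemma eucl_normN v : eucl_norm (- v) = eucl_norm v.
Proof. by rewrite -scaleN1r eucl_normZ normrN normr1 mul1r. Qed.

Lemma eucl_dist_sym u v : eucl_norm (u - v) = eucl_norm (v - u).
Proof. by rewrite -eucl_normN opprB. Qed.

(** The sum of the squares of a u_i - b v_i is nonnegative for all real a, b. *)
Lemma cauchy_schwarz u v :
  `|\sum_(i < m) u 0 i * v 0 i| <= eucl_norm u * eucl_norm v.
Proof.
set s := \sum_(i < m) u 0 i * v 0 i.
have nn (a b : R) : 0 <= a ^+ 2 * eucl_norm u ^+ 2 - a * b * s *+ 2
    + b ^+ 2 * eucl_norm v ^+ 2.
  have -> : a ^+ 2 * eucl_norm u ^+ 2 - a * b * s *+ 2 + b ^+ 2 * eucl_norm v ^+ 2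
      = \sum_(i < m) (a * u 0 i - b * v 0 i) ^+ 2.
    rewrite !sqr_eucl_norm /s !mulr_sumr -sumrMnl -sumrB -big_split/=.
    by apply: eq_bigr => i _; ring.
  by apply: sumr_ge0 => i _; exact: sqr_ge0.
rewrite -ler_sqr ?nnegrE ?mulr_ge0 ?eucl_norm_ge0//.
rewrite real_normK ?num_real// exprMn.
move: nn (sqr_ge0 (eucl_norm u)) (sqr_ge0 (eucl_norm v)).
move: (eucl_norm u ^+ 2) (eucl_norm v ^+ 2) => a b nn a0 b0.
have [b_gt0|] := ltP 0 b.
  rewrite -subr_ge0 -(pmulr_rge0 _ b_gt0).
  (* b (a b - s^2) is the quadratic form at (b, s) *)
  by apply: le_trans (nn b s) _; rewrite le_eqVlt; apply/orP; left; apply/eqP; ring.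
move=> b_le0; have bE : b = 0 by apply/eqP; rewrite eq_le b_le0.
have a2 : 0 < a + 2 by rewrite ltr_wpDl.
rewrite bE mulr0 -oppr_ge0 -(pmulr_rge0 _ a2).
(* if b = 0, the form at (s, a + 1) is - (a + 2) s^2, which forces s = 0 *)
by apply: le_trans (nn s (a + 1)) _; rewrite bE le_eqVlt; apply/orP; left; apply/eqP; ring.
Qed.

Lemma le_coord_eucl_norm v i : `|v 0 i| <= eucl_norm v.
Proof.
rewrite -ler_sqr ?nnegrE ?eucl_norm_ge0// real_normK ?num_real// sqr_eucl_norm.
rewrite (bigD1 i)//= lerDl; apply: sumr_ge0 => j _; exact: sqr_ge0.
Qed.

Lemma continuous_eucl_norm : continuous (eucl_norm : V -> R).
Proof.
have cs : continuous (fun v : V => \sum_(i < m) v 0 i ^+ 2).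
  move=> v; apply: (@cvg_big R _ _ _ _ (@add_continuous R) V (nbhs v)) => i _.
  have ci : {for v, continuous (fun w : V => w 0 i)} by exact: coord_continuous.
  by under eq_fun do rewrite expr2; rewrite expr2; exact: cvgM.
by move=> v; apply: (continuous_comp (cs v)); exact: sqrt_continuous.
Qed.

Lemma hausdorff_dist_le A B (M : \bar R) :
  (forall a, A a -> exists2 b, B b & ((eucl_norm (a - b))%:E <= M)%E) ->
  (forall b, B b -> exists2 a, A a & ((eucl_norm (b - a))%:E <= M)%E) ->
  (hausdorff_dist A B <= M)%E.
Proof.
move=> AB BA; rewrite /hausdorff_dist ge_max; apply/andP; split;
  apply: ge_ereal_sup => _ /= [x Xx <-]; apply: ge_ereal_inf.
- by have [b Bb ab] := AB _ Xx; exists (eucl_norm (x - b))%:E => //; exists b.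
- by have [b Bb ab] := BA _ Xx; exists (eucl_norm (x - b))%:E => //; exists b.
Qed.

Lemma hausdorff_dist11 u v :
  hausdorff_dist [set u] [set v] = (eucl_norm (u - v))%:E.
Proof.
by rewrite /hausdorff_dist /eucl_dist_set !image_set1 !ereal_sup1 !ereal_inf1
  eucl_dist_sym maxxx.
Qed.

Lemma set_norm1 v : set_norm [set v] = (eucl_norm v)%:E.
Proof. by rewrite /set_norm hausdorff_dist11 subr0. Qed.

Lemma le_set_norm A v : A v -> ((eucl_norm v)%:E <= set_norm A)%E.
Proof.
move=> Av; rewrite /set_norm /hausdorff_dist le_max; apply/orP; left.
apply: ereal_sup_ubound; exists v => //.
by rewrite /eucl_dist_set image_set1 ereal_inf1 subr0.
Qed.

Lemma set_norm_fin_num A : A !=set0 -> compact A -> set_norm A \is a fin_num.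
Proof.
move=> [w Aw] cA.
have A0 : A !=set0 by exists w.
have [|c Ac cmax] := @compact_EVT_max V R eucl_norm A A0 cA.
  by apply: continuous_subspaceT; exact: continuous_eucl_norm.
have le_c v : A v -> eucl_norm v <= eucl_norm c by move=> Av; apply: cmax; exact: mem_set.
rewrite ge0_fin_numE; last first.
  by apply: le_trans (le_set_norm Aw); rewrite lee_fin eucl_norm_ge0.
apply: (@le_lt_trans _ _ (eucl_norm c)%:E); last exact: ltry.
apply: hausdorff_dist_le => [a Aa|_ ->].
  by exists 0 => //; rewrite subr0 lee_fin le_c.
by exists w => //; rewrite sub0r eucl_normN lee_fin le_c.
Qed.

End EuclideanNorm.

(** x^-1 is x times the square of |x|^-1, also at 0, and real powers are
    measurable. *)
Lemma measurable_invr (R : realType) : measurable_fun [set: R] (fun x : R => x^-1).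
Proof.
have -> : (fun x : R => x^-1) =
    (fun x => x * (`|x| `^ (-1) * `|x| `^ (-1))).
  apply/funext => x; rewrite powR_inv1// -invfM -expr2 real_normK ?num_real//.
  by have [->|x0] := eqVneq x 0; [rewrite invr0 mul0r|rewrite expr2 invfM mulVKf].
have mn : measurable_fun [set: R] (fun x : R => `|x| `^ (-1)).
  by apply: (measurableT_comp (measurable_powR (-1))); exact: normr_measurable.
by apply: measurable_funM => //; exact: measurable_funM.
Qed.

Section VectorIntegral.
Context {R : realType} {m : nat}.
Local Notation V := 'rV[R]_m.
Local Notation mu := (leb R).
Local Notation D := (@period R).

(** Pair the integral v with itself: |v|^2 is the integral of <v, phi>, hence at
    most |v| times the integral of G by the Cauchy-Schwarz inequality. The
    majorant G of |phi| is the form in which Hoelder's inequality applies. *)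
Lemma eucl_norm_vec_integral (phi : R -> V) (G : R -> R) :
  vec_integrable phi ->
  measurable_fun [set: lebR R] (G : lebR R -> R) -> (forall t, 0 <= G t) ->
  {ae mu, forall t : lebR R, D t -> eucl_norm (phi t) <= G t} ->
  ((eucl_norm (vec_integral phi))%:E <= \int[mu]_(t in D) (G t)%:E)%E.
Proof.
move=> iphi mG G0 phiG; have mD := @measurable_period R.
set v := vec_integral phi; set N := eucl_norm v.
have N0 : 0 <= N by exact: eucl_norm_ge0.
pose S t := (\sum_(i < m) (v 0 i * phi t 0 i)%:E)%E.
have iS i : mu.-integrable D (fun t => (v 0 i * phi t 0 i)%:E).
  under eq_fun do rewrite EFinM.
  exact: (integrableZl mD _ (iphi i)).
have mS : measurable_fun D S.
  by apply: emeasurable_sum => i; exact: (measurable_int _ (iS i)).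
have vS : ((N ^+ 2)%:E = \int[mu]_(t in D) S t)%E.
  rewrite /S integral_sum// sqr_eucl_norm -sumEFin; apply: eq_bigr => i _.
  under [RHS]eq_integral do rewrite EFinM.
  rewrite (integralZl mD (iphi i)).
  rewrite expr2 EFinM; congr (_ * _)%E.
  by rewrite /v mxE /Rintegral fineK//; exact: (integrable_fin_num mD (iphi i)).
have NG : ((N ^+ 2)%:E <= N%:E * \int[mu]_(t in D) (G t)%:E)%E.
  have mGD : measurable_fun D (EFin \o (G : lebR R -> R)).
    by apply/measurable_EFinP; exact: measurable_funTS.
  rewrite -ge0_integralZl_EFin//; last by move=> t _; rewrite lee_fin.
  rewrite -[leLHS]gee0_abs ?lee_fin ?sqr_ge0// vS.
  apply: le_trans (le_abse_integral _ _ _) _ => //.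
  apply: (ae_ge0_le_integral mD).
  - by move=> t _; exact: abse_ge0.
  - by apply: measurableT_comp; first exact: abse_measurable.
  - by move=> t _; rewrite -EFinM lee_fin mulr_ge0.
  - exact: measurable_funeM.
  apply: filterS phiG => t h Dt.
  rewrite /S sumEFin -EFinM lee_fin.
  apply: le_trans (cauchy_schwarz _ _) _.
  by apply: ler_wpM2l => //; exact: h.
have [N00|Nn0] := eqVneq N 0.
  by rewrite N00; apply: integral_ge0 => t _; rewrite lee_fin.
have Ngt0 : 0 < N by rewrite lt_neqAle eq_sym Nn0.
by move: NG; rewrite expr2 EFinM lee_pmul2l.
Qed.

End VectorIntegral.

(** * The upper estimate *)

Lemma hausdorff_dist_ge0 (R : realType) (m : nat) (A B : set 'rV[R]_m) :
  A !=set0 -> (0 <= hausdorff_dist A B)%E.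
Proof.
move=> [a Aa]; rewrite /hausdorff_dist le_max; apply/orP; left.
apply: (@le_trans _ _ (eucl_dist_set a B)).
  by apply/ereal_infP => _ [b _ <-]; rewrite lee_fin eucl_norm_ge0.
by apply: ereal_sup_ubound; exists a.
Qed.

Section UpperBound.
Context {R : realType} {m : nat}.
Local Notation V := 'rV[R]_m.
Local Notation mu := (leb R).
Local Notation D := (@period R).
Local Notation P := (pi *+ 2 : R).
Local Notation meas f := (measurable_fun [set: lebR R] (f : lebR R -> R)).
Variables (p q : \bar R).
Hypotheses (p1 : (1 <= p)%E) (q1 : (1 <= q)%E) (pq : (p^-1 + q^-1 = 1)%E).
Implicit Types (g : R -> set V).

(** Compactness makes the norm of each value finite, so the extended-valued
    function can be replaced by a real one. *)
Lemma Phi_set_norm g : Phi p g -> let N t := fine (set_norm (g t)) in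
  [/\ meas N, forall t, set_norm (g t) = (N t)%:E, forall t, 0 <= N t &
   (Lp_norm p (EFin \o N) <= 1)%E].
Proof.
move=> [[[cg mg pg ig] [mN pN Noo]] g1] /=.
have fin t : set_norm (g t) \is a fin_num.
  by case: (cg t) => g0 cgt; exact: set_norm_fin_num.
have NE t : set_norm (g t) = (fine (set_norm (g t)))%:E by rewrite fineK.
split => //.
  move=> t; apply: fine_ge0; have [[v gv] _] := cg t.
  by apply: le_trans (le_set_norm gv); rewrite lee_fin eucl_norm_ge0.
apply: le_trans g1; rewrite /dist_LpA le_eqVlt; apply/orP; left; apply/eqP.
by congr Lp_norm; apply/funext => t /=; rewrite -NE.
Qed.

(** The heart of the upper estimate. A point of K1 * g (x) is the integral of
    some psi with psi t in K1 (x - t) g t. Writing psi t = K1 (x - t) phi t with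
    a measurable selection phi of g, the integral of K2 (x - t) phi t is a point
    of K2 * g (x), and the difference of the two points is the integral of
    (K1 - K2) (x - t) phi t, to which Hoelder's inequality applies. *)
Lemma sv_conv_near (K1 K2 : R -> R) g x a : Lp q K1 -> Lp q K2 -> Phi p g ->
  sv_conv K1 g x a ->
  exists2 b, sv_conv K2 g x b &
    ((eucl_norm (a - b))%:E <= Lp_norm q (fun t => (K1 t - K2 t)%:E))%E.
Proof.
move=> [mK1 pK1 K1oo] [mK2 pK2 K2oo] Pg; have mD := @measurable_period R.
have [mN NE N0 N1] := Phi_set_norm Pg.
set N := fun t => fine (set_norm (g t)) in mN NE N0 N1.
have Noo : (Lp_norm p (EFin \o N) < +oo)%E by apply: le_lt_trans N1 _; exact: ltry.
have [[[cg mg _ _] _] _] := Pg.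
have [phi0 [phi0g mphi0]] := @measurable_selection _ (lebR R) R m g cg mg.
move=> [psi [ipsi psiK] <-].
pose k1 t := K1 (x - t); pose k2 t := K2 (x - t).
have mk1 : meas k1 by exact: measurable_comp_refl.
have mk2 : meas k2 by exact: measurable_comp_refl.
(* psi determines phi only where the kernel does not vanish *)
pose phi t := if k1 t == 0 then phi0 t else (k1 t)^-1 *: psi t.
have phiP : {ae mu, forall t : lebR R, D t ->
    g t (phi t) /\ psi t = k1 t *: phi t}.
  apply: filterS psiK => t h /h [v gv]; rewrite -/(k1 t) => vpsi.
  rewrite /phi; case: eqVneq => [k0|kn0].
    by split; [exact: phi0g|rewrite -vpsi k0 !scale0r].
  by rewrite -vpsi !scalerA ?(mulfV kn0) ?(mulVf kn0) ?mul1r ?mulr1 ?scale1r.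
have mphi i : measurable_fun D (fun t : lebR R => phi t 0 i).
  have -> : (fun t : lebR R => phi t 0 i) = (fun t =>
      if k1 t == 0 then phi0 t 0 i else (k1 t)^-1 * psi t 0 i).
    by apply/funext => t; rewrite /phi; case: ifP; rewrite ?mxE.
  apply: (measurable_fun_if mD).
  - apply: measurable_funTS; apply: measurable_fun_eqr; first exact: mk1.
    exact: measurable_cst.
  - by apply: measurable_funTS; exact: mphi0.
  - apply: (measurable_funS mD (@subIsetl _ _ _)).
    apply: measurable_funM.
      by apply: measurable_funTS; exact: (measurableT_comp (@measurable_invr R) mk1).
    by apply/measurable_EFinP; exact: (measurable_int _ (ipsi i)).
have hoeld f : meas f -> (Lp_norm q (EFin \o f) < +oo)%E ->
    (\int[mu]_(t in D) (`|f t * N t|)%:E <= Lp_norm q (EFin \o f))%E.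
  move=> mf foo; apply: le_trans (hoelder_period p1 q1 pq mf mN foo Noo) _.
  by rewrite -[leRHS]mule1 lee_wpmul2l// Lp_norm_ge0.
have iphi : vec_integrable (fun t => k2 t *: phi t).
  move=> i.
  have mk : measurable_fun D (fun t : lebR R => k2 t * phi t 0 i).
    by apply: measurable_funM => //; exact: measurable_funTS.
  under eq_fun do rewrite mxE.
  apply/integrableP; split; first exact/measurable_EFinP.
  have k2oo : (Lp_norm q (EFin \o k2) < +oo)%E.
    by apply: le_lt_trans (Lp_norm_refl x q1 mK2 pK2) K2oo.
  apply: le_lt_trans (le_trans _ (hoeld _ mk2 k2oo)) k2oo.
  apply: (ae_ge0_le_integral mD).
  - by move=> t _; exact: abse_ge0.
  - by apply: measurableT_comp; [exact: abse_measurable|exact/measurable_EFinP].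
  - by move=> t _; rewrite lee_fin.
  - apply/measurable_EFinP; apply: measurableT_comp; first exact: normr_measurable.
    by apply: measurable_funM; apply: measurable_funTS; [exact: mk2|exact: mN].
  apply: filterS phiP => t h /h [gphi _]; rewrite /= lee_fin !normrM.
  apply: ler_wpM2l => //; apply: le_trans (le_coord_eucl_norm _ _) _.
  by rewrite (ger0_norm (N0 t)) -lee_fin -NE le_set_norm.
exists (vec_integral (fun t => k2 t *: phi t)).
  exists (fun t => k2 t *: phi t) => //; split => //.
  by apply: filterS phiP => t h /h [gphi _]; exists (phi t).
pose chi t := psi t - k2 t *: phi t.
have ichi : vec_integrable chi.
  move=> i; rewrite (_ : (fun t => _) = (fun t => (psi t 0 i)%:E) \-
    (fun t => ((k2 t *: phi t) 0 i)%:E))%E.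
    exact: (integrableB mD (ipsi i) (iphi i)).
  by apply/funext => t; rewrite /chi !mxE.
have -> : vec_integral psi - vec_integral (fun t => k2 t *: phi t) = vec_integral chi.
  apply/rowP => i; rewrite !mxE -(RintegralB mD (ipsi i) (iphi i)).
  by apply: eq_Rintegral => t _; rewrite /chi !mxE.
pose d t := K1 t - K2 t.
have md : meas d by exact: measurable_funB.
have pd : periodic d P by move=> t; rewrite /d pK1 pK2.
have mdx : meas (fun t => d (x - t)) by exact: measurable_comp_refl.
have doo : (Lp_norm q (EFin \o (fun t => d (x - t)%R)) < +oo)%E.
  apply: le_lt_trans (Lp_norm_refl x q1 md pd) _.
  exact: Lp_normB_lty.
apply: le_trans (le_trans _ (hoeld _ mdx doo)) (Lp_norm_refl x q1 md pd).
apply: (eucl_norm_vec_integral ichi).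
- apply: measurableT_comp; first exact: normr_measurable.
  by apply: measurable_funM; [exact: mdx|exact: mN].
- by move=> t; exact: normr_ge0.
apply: filterS phiP => t h /h [gphi psiE].
rewrite /chi psiE -scalerBl eucl_normZ normrM.
apply: ler_wpM2l => //.
by rewrite (ger0_norm (N0 t)) -lee_fin -NE le_set_norm.
Qed.

(** The zero kernel gives a convolution that contains 0, and any point of it
    has a companion in K * g (x). Nonemptiness matters: between two empty sets
    the Hausdorff distance of the definition is -oo. *)
Lemma sv_conv_nonempty (K : R -> R) g x : Lp q K -> Phi p g ->
  sv_conv K g x !=set0.
Proof.
move=> LK Pg.
have L0 : Lp q (fun=> 0 : R).
  have m0 : meas (fun=> 0 : R) by exact: measurable_cst.
  by split => //; apply: (Lp_norm_bounded (M := 0) q1 m0) => t; rewrite normr0.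
have [|b Kb _] := @sv_conv_near (fun=> 0) K g x 0 L0 LK Pg; last by exists b.
have [[[cg _ _ _] _] _] := Pg.
exists (fun=> 0); last first.
  apply/rowP => i; rewrite !mxE Rintegral_cst ?mul0r//.
  exact: measurable_period.
split => [i|].
  by rewrite mxE; exact: integrable0.
by apply: aeW => t _; have [[v gv] _] := cg t; exists v => //; rewrite scale0r.
Qed.

Lemma dist_sv_conv_le (K1 K2 : R -> R) g : Lp q K1 -> Lp q K2 -> Phi p g ->
  (dist_LpA +oo (sv_conv K1 g) (sv_conv K2 g) <=
   Lp_norm q (fun t => (K1 t - K2 t)%:E))%E.
Proof.
move=> LK1 LK2 Pg; apply/Lp_normyP; first exact: Lp_norm_ge0.
apply: aeW => x _.
rewrite gee0_abs; last exact/hausdorff_dist_ge0/sv_conv_nonempty.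
apply: hausdorff_dist_le => a ha; first exact: (sv_conv_near LK1 LK2 Pg ha).
have [b hb ab] := sv_conv_near LK2 LK1 Pg ha; exists b => //.
apply: le_trans ab _; rewrite le_eqVlt; apply/orP; left; apply/eqP.
by apply: (@eq_norm_Lp_norm R q (fun t => K2 t - K1 t) (fun t => K1 t - K2 t));
  move=> t; rewrite distrC.
Qed.

End UpperBound.

(** * Continuity of translations in the mean *)

Section BorelApproximation.
Context {R : realType}.
Local Notation mu := (leb R).
Local Notation meas f := (measurable_fun [set: lebR R] (f : lebR R -> R)).

(** Replace each level set {f > s}, s rational, by a Borel subset B s that
    differs from it by a null set, and take the supremum of the s with t in
    B s. *)
Lemma ae_eq_borel (f : R -> R) : meas f -> exists f' : R -> R,
  measurable_fun [set: R] f' /\ {ae mu, forall t : lebR R, f t = f' t}.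
Proof.
move=> mf.
have mA (s : rat) : measurable [set t : lebR R | ratr s < f t].
  rewrite (_ : [set _ | _] = f @^-1` `]ratr s, +oo[).
    by rewrite -[X in measurable X]setTI; exact: mf.
  by apply/seteqP; split => t /=; rewrite in_itv/= andbT.
pose B s := sval (cid (lebR_borel_decomp (mA s))).
have BP s : exists N : set (measurableTypeR R), [/\ measurable (B s),
    B s `<=` [set t | ratr s < f t],
    [set t | ratr s < f t] `\` B s `<=` N, measurable N &
    lebesgue_measure N = 0%E].
  by rewrite /B; case: cid.
pose S t := [set x : \bar R | exists2 s : rat, B s t & x = (ratr s)%:E].
pose f' (t : R) : R := fine (ereal_sup (S t)).
exists f'; split.
  apply: measurableT_comp; first exact: fine_measurable.
  move=> mT; apply: (measurability _ (ErealGenOInfty.measurableE R)) => //.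
  move=> _ [_ [r ->] <-]; rewrite setTI.
  pose C (s : rat) := B s `&` [set t : R | r < ratr s].
  rewrite (_ : _ @^-1` _ = \bigcup_s C s).
    apply: bigcupT_measurable_rat => s; have [N [mB _ _ _ _]] := BP s.
    apply: measurableI => //.
    have [rs|rs] := ltP r (ratr s).
      by rewrite (_ : [set _ | _] = setT)//; apply/seteqP; split.
    by rewrite (_ : [set _ | _] = set0)//; apply/seteqP; split.
  apply/seteqP; split => t /=; rewrite in_itv/= andbT.
    by move=> /ereal_sup_gt[_ [s Bst ->]]; rewrite lte_fin => rs; exists s.
  move=> [s _ [Bst /= rs]]; apply/ereal_sup_gtP; exists (ratr s)%:E => //.
  by exists s.
have : {ae mu, forall t : lebR R, forall k : nat, forall s : rat,
    unpickle k = Some s -> ratr s < f t -> B s t}.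
  apply: ae_foralln => k; case: (unpickle k) => [s|]; last exact: aeW.
  have [N [mB BA AN mN N0]] := BP s.
  exists N; split; [exact: borel_lebR|exact: N0|].
  move=> t /=; apply: contra_notP => nN _ [<-] sf.
  by apply: contrapT => nB; apply: nN; exact: AN.
apply: filterS => t h.
suff : ereal_sup (S t) = (f t)%:E by rewrite /f' => ->.
apply/eqP; rewrite eq_le; apply/andP; split.
  apply: ge_ereal_sup => _ [s Bs ->]; rewrite lee_fin ltW//.
  by have [N [_ BA _ _ _]] := BP s; exact: BA.
rewrite leNgt; apply/negP => Sf.
have [y /andP[Sy yf]] : exists y : R, (ereal_sup (S t) <= y%:E)%E && (y < f t).
  case: (ereal_sup (S t)) Sf => [y yf|//|_].
    by exists y; rewrite lexx -lte_fin.
  by exists (f t - 1); apply/andP; split; [exact: leNye|rewrite ltrBlDr ltrDl].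
have [s] := rat_in_itvoo yf; rewrite in_itv/= => /andP[ys sf].
have Bs : B s t by apply: (h (pickle s) s) => //; exact: pickleK.
have : ((ratr s)%:E <= ereal_sup (S t))%E by apply: ereal_sup_ubound; exists s.
by move=> /le_trans/(_ Sy); rewrite lee_fin leNgt ys.
Qed.

Lemma ge0_integral_borel (E : set R) (F : R -> \bar R) :
  measurable E -> measurable_fun [set: R] F -> (forall t, 0 <= F t)%E ->
  (\int[mu]_(t in (E : set (lebR R))) F t =
   \int[lebesgue_measure]_(t in E) F t)%E.
Proof.
move=> mE mF F0.
have mid : measurable_fun [set: lebR R] (id : lebR R -> measurableTypeR R).
  by apply: borel_fun_lebR; exact: measurable_id.
transitivity (\int[pushforward mu (id : lebR R -> measurableTypeR R)]_(t in E) F t)%E.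
  rewrite (ge0_integral_pushforward mid)//; first exact: measurable_funTS.
by apply: (@eq_measure_integral _ (measurableTypeR R) _ E (@lebesgue_measure R)
  (pushforward_measure mu mid) F).
Qed.

(** Continuous functions are L1-dense among Borel functions; almost everywhere
    equality carries this over to Lebesgue measurable ones. *)
Lemma continuous_approx_L1 (f : R -> R) (a b e : R) : meas f ->
  mu.-integrable (`[a, b] : set (lebR R)) (EFin \o f) -> 0 < e ->
  exists2 g : R -> R, continuous g &
    (\int[mu]_(t in (`[a, b] : set (lebR R))) (`|f t - g t|)%:E < e%:E)%E.
Proof.
move=> mf intf e0.
have [f' [mf' ff']] := ae_eq_borel mf.
have mab : measurable (`[a, b] : set (lebR R)) by exact: measurable_lebR_itv.
have mf'' : meas f' by exact: borel_fun_lebR.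
have mab' : measurable (`[a, b] : set R) by exact: measurable_itv.
have intf' : lebesgue_measure.-integrable `[a, b] (EFin \o f').
  apply/integrableP; split.
    by apply/measurable_EFinP; exact: measurable_funTS.
  rewrite -ge0_integral_borel; last first.
  - by move=> t; exact: abse_ge0.
  - by apply: measurableT_comp; [exact: abse_measurable|exact/measurable_EFinP].
  - exact: mab'.
  case/integrableP : intf => _; apply: le_lt_trans.
  rewrite le_eqVlt; apply/orP; left; apply/eqP.
  apply: (ge0_ae_eq_integral mab).
  - apply: measurable_funTS; apply: measurableT_comp; first exact: abse_measurable.
    exact/measurable_EFinP.
  - apply: measurable_funTS; apply: measurableT_comp; first exact: abse_measurable.
    exact/measurable_EFinP.
  - by move=> t _; exact: abse_ge0.
  - by move=> t _; exact: abse_ge0.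
  - by apply: filterS ff' => t /= ->.
have abfin : (lebesgue_measure (`[a, b]%classic : set R) < +oo)%E.
  by rewrite lebesgue_measure_itv/=; case: ifP => // _; rewrite -EFinB ltry.
have [g [cg _ gcvg]] := approximation_continuous_integrable mab' abfin intf'.
have [n _ gn] : \forall n \near \oo,
    (\int[lebesgue_measure]_(z in `[a, b]) `|(f' z - g n z)%:E| < e%:E)%E.
  apply: (gcvg [set y | (y < e%:E)%E]); apply: open_nbhs_nbhs.
  by split; [exact: open_ereal_lt_ereal|rewrite /= lte_fin].
exists (g n) => //.
have mg : measurable_fun [set: R] (g n) by apply: continuous_measurable_fun.
move: (gn n (leqnn n)) => gnn; apply: le_lt_trans gnn.
rewrite -ge0_integral_borel; last first.
- by move=> t; exact: abse_ge0.
- apply: measurableT_comp; first exact: abse_measurable.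
  by apply/measurable_EFinP; exact: measurable_funB.
- exact: mab'.
rewrite le_eqVlt; apply/orP; left; apply/eqP.
apply: (ge0_ae_eq_integral mab).
- apply: measurable_funTS; apply/measurable_EFinP.
  apply: measurableT_comp; first exact: normr_measurable.
  by apply: measurable_funB => //; exact: borel_fun_lebR.
- apply: measurable_funTS; apply: measurableT_comp; first exact: abse_measurable.
  by apply/measurable_EFinP; apply: measurable_funB => //; exact: borel_fun_lebR.
- by move=> t _; rewrite lee_fin.
- by move=> t _; exact: abse_ge0.
- by apply: filterS ff' => t /= ->.
Qed.

End BorelApproximation.

Section TranslationContinuity.
Context {R : realType}.
Local Notation mu := (leb R).
Local Notation D := (@period R).
Local Notation P := (pi *+ 2 : R).
Local Notation meas f := (measurable_fun [set: lebR R] (f : lebR R -> R)).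

Lemma ge0_integral_refl x (E : set (lebR R)) (F : lebR R -> \bar R) :
  measurable E -> measurable_fun E F -> (forall t, 0 <= F t)%E ->
  (\int[mu]_(t in (fun t => x - t)%R @^-1` E) F (x - t)%R =
   \int[mu]_(s in E) F s)%E.
Proof.
move=> mE mF F0.
rewrite -(@ge0_integral_pushforward _ _ _ _ R
  (fun t : lebR R => (x - t : lebR R)) (@measurable_lebR_refl R x) mu E F mE mF); last first.
  by move=> t _; exact: F0.
apply: (@eq_measure_integral _ (lebR R) _ E mu
  (pushforward_measure mu (@measurable_lebR_refl R x)) F).
by move=> A mA _; exact: leb_refl.
Qed.

(** Heine's theorem in the one-sided form used for small translations to the
    right. *)
Lemma uniform_continuity_right (g : R -> R) (a b e : R) : continuous g -> 0 < e ->
  exists2 eta : R, 0 < eta & forall x s, 0 <= x -> x <= eta ->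
    a <= s <= b -> `|g (x + s) - g s| <= e.
Proof.
move=> cg e0.
have e20 : 0 < e / 2 by rewrite divr_gt0.
have /compact_near_coveringP cab := @segment_compact R a b.
have := cab R (nbhs (0 : R)) (fun x s => `|g (x + s) - g s| <= e) _.
case=> [s _|eta /= eta0 h].
  have /cvgrPdist_lt/(_ _ e20) gs := cg s.
  have gs1 : \forall z \near (nbhs s, nbhs (0 : R)), `|g s - g z.1| < e / 2.
    exact: cvg_fst gs.
  have gs2 : \forall z \near (nbhs s, nbhs (0 : R)), `|g s - g (z.2 + z.1)| < e / 2.
    have : (fun z : R * R => z.2 + z.1) z @[z --> (nbhs s, nbhs (0 : R))] --> s.
      by rewrite -[X in _ --> X]add0r; apply: cvgD; [exact: cvg_snd|exact: cvg_fst].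
    by move=> /(_ _ gs).
  apply: filterS2 gs1 gs2 => z z1 z2 /=.
  rewrite -(subrK (g s) (g (z.2 + z.1))) -addrA (le_trans (ler_normD _ _))//.
  by rewrite [e]splitr lerD// ltW// distrC.
exists (eta / 2); first by rewrite divr_gt0.
move=> x s x0 xeta sab; apply: h; last by rewrite /= in_itv.
rewrite /= sub0r normrN ger0_norm// (le_lt_trans xeta)//.
by rewrite ltr_pdivrMr// ltr_pMr// ltr1n.
Qed.

(** Replace f by a continuous g that is close to it in L1 on [-2 pi, 2 pi],
    which contains all the points -t and x - t; for g the claim is uniform
    continuity. *)
Lemma translation_continuous (f : R -> R) (e : R) : meas f -> periodic f P ->
  mu.-integrable D (EFin \o f) -> 0 < e ->
  exists2 eta : R, 0 < eta & forall x, 0 <= x -> x <= eta ->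
    (\int[mu]_(t in D) (`|f (x - t)%R - f (- t)%R|)%:E <= e%:E)%E.
Proof.
move=> mf pf intf e0; have mD := @measurable_period R.
have P0 : 0 < P by rewrite mulrn_wgt0 ?pi_gt0.
pose J : set (lebR R) := `[- P, P]%classic.
have mJ : measurable J by exact: measurable_lebR_itv.
have absm u (E : set (lebR R)) : meas u -> measurable_fun E (fun t => (`|u t|)%:E).
  move=> mU; apply: measurable_funTS; apply/measurable_EFinP.
  by apply: measurableT_comp; first exact: normr_measurable.
have preimD x : (fun t => x - t) @^-1` (`[x - P, x] : set (lebR R)) = D.
  by apply/seteqP; split => t /=; rewrite /period/= !in_itv/= => /andP[? ?];
    apply/andP; split; lra.
have mitv a b : measurable (`[a, b] : set (lebR R)) by exact: measurable_lebR_itv.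
have chg u x : meas u ->
    (\int[mu]_(t in D) (`|u (x - t)%R|)%:E =
     \int[mu]_(s in (`[(x - P)%R, x] : set (lebR R))) (`|u s|)%:E)%E.
  move=> mU.
  rewrite -(preimD x).
  exact: (@ge0_integral_refl x (`[x - P, x] : set (lebR R))
    (fun s => (`|u s|)%:E) (mitv _ _) (absm _ _ mU)).
have intJ : mu.-integrable J (EFin \o f).
  apply/integrableP; split.
    by apply: measurable_funTS; exact/measurable_EFinP.
  have -> : J = (`[- P, 0[ : set (lebR R)) `|` D.
    apply/seteqP; split => t; rewrite /J /period/= !in_itv/=.
      by move=> /andP[t1 t2]; have [t0|t0] := ltP t 0; [left|right];
        apply/andP; split.
    by move=> [] /andP[? ?]; apply/andP; split; lra.
  have mo : measurable (`[- P, 0[ : set (lebR R)) by exact: measurable_lebR_itv.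
  rewrite (ge0_integral_setU mu mo mD); last 3 first.
  - exact: absm.
  - by move=> t _; exact: abse_ge0.
  - apply/disj_setPRL => t /=; rewrite /period/= !in_itv/= => /andP[t0 _].
    by apply/negP; rewrite negb_and -leNgt t0 orbT.
  case/integrableP : (intf) => _ foo; apply: lte_add_pinfty => //.
  apply: le_lt_trans foo.
  have eqR : (\int[mu]_(t in D) (`|f (0 - t)%R|)%:E = \int[mu]_(t in D) (`|f t|)%:E)%E.
    apply: (@ge0_integral_period_refl _ f (fun y => (`|y|)%:E) 0 mf pf).
      by apply/measurable_EFinP; exact: normr_measurable.
    by move=> y; rewrite lee_fin.
  rewrite -[leRHS]eqR (chg f 0 mf) sub0r.
  apply: (@ge0_subset_integral _ _ _ mu _ _ mo (mitv (- P) 0)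
    (fun t => (`|f t|)%:E) (absm f _ mf)).
    by move=> t _; rewrite lee_fin.
  by move=> t /=; rewrite !in_itv/= => /andP[-> /ltW ->].
have e30 : 0 < e / 3 by rewrite divr_gt0.
have [g cg fg] := continuous_approx_L1 mf intJ e30.
have mg : meas g by apply: borel_fun_lebR; exact: continuous_measurable_fun.
(* the period has length P, so this bound integrates to e / 3 *)
have e4 : 0 < e / 3 / P by rewrite divr_gt0.
have [eta eta0 geta] := uniform_continuity_right (- P) 0 cg e4.
(* x <= P keeps the points x - t in J *)
exists (Num.min eta P); first by rewrite lt_min eta0.
move=> x x0; rewrite le_min => /andP[xeta xP].
pose u t := f t - g t.
have mU : meas u by exact: measurable_funB.
have small y : 0 <= y -> y <= P -> (\int[mu]_(t in D) (`|u (y - t)%R|)%:E <= (e / 3)%:E)%E.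
  move=> y0 yP; rewrite (chg u y mU); apply: le_trans (ltW fg).
  apply: (@ge0_subset_integral _ _ _ mu _ _ (mitv (y - P) y) mJ
    (fun t => (`|u t|)%:E) (absm u _ mU)).
    by move=> t _; rewrite lee_fin.
  by move=> t; rewrite /J/= !in_itv/= => /andP[? ?]; apply/andP; split; lra.
have mux y : measurable_fun D (fun t => (`|u (y - t)%R|)%:E).
  by apply: (absm (fun t => u (y - t))); exact: measurable_comp_refl.
pose w t := g (x - t) - g (0 - t).
have mw : measurable_fun D (fun t => (`|w t|)%:E).
  apply: absm; apply: measurable_funB; exact: measurable_comp_refl.
apply: (@le_trans _ _ (\int[mu]_(t in D)
    ((`|u (x - t)|)%:E + ((`|u (0 - t)%R|)%:E + (`|w t|)%:E)))%E).
  refine (@ge0_le_integral _ _ _ mu D mD _ _ _ _ _ _).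
  - by move=> t _; rewrite lee_fin.
  - apply: (absm (fun t => f (x - t) - f (- t))).
    apply: measurable_funB; first exact: measurable_comp_refl.
    have := measurable_comp_refl 0 mf; under eq_fun do rewrite sub0r; exact.
  - exact: (emeasurable_funD (mux x) (emeasurable_funD (mux 0) mw)).
  - move=> t _; rewrite -!EFinD lee_fin /u /w sub0r.
    rewrite (_ : f (x - t) - f (- t) = (f (x - t) - g (x - t)) +
      (- (f (- t) - g (- t)) + (g (x - t) - g (- t)))); last by ring.
    apply: le_trans (ler_normD _ _) _; rewrite lerD2l.
    by apply: le_trans (ler_normD _ _) _; rewrite normrN.
have gt0 : forall v : R -> R, forall t, D t -> (0 <= (`|v t|)%:E)%E.
  by move=> v t _; rewrite lee_fin.
rewrite (ge0_integralD mu mD (gt0 (fun t => u (x - t))) (mux x)); last 2 first.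
- by move=> t _; rewrite -EFinD lee_fin addr_ge0.
- exact: (emeasurable_funD (mux 0) mw).
rewrite (ge0_integralD mu mD (gt0 (fun t => u (0 - t))) (mux 0) (gt0 w) mw).
have -> : e = e / 3 + (e / 3 + e / 3) by lra.
rewrite !EFinD; apply: leeD; first exact: small.
apply: leeD; first by apply: small => //; exact: ltW.
apply: (@le_trans _ _ (\int[mu]_(t in D) (e / 3 / P)%:E)%E).
  refine (@ge0_le_integral _ _ _ mu D mD _ _ _ _ _ _).
  - by move=> t _; rewrite lee_fin.
  - exact: mw.
  - exact: measurable_cst.
  - move=> t; rewrite /period/= in_itv/= => /andP[t0 tP].
    rewrite lee_fin /w sub0r; apply: geta => //.
    by apply/andP; split; lra.
rewrite (integral_cst mu mD) leb_period -EFinM lee_fin.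
by rewrite divfK// gt_eqF.
Qed.

End TranslationContinuity.

(** * Extremal functions in the duality of Lp and Lq *)

Section DualExtremal.
Context {R : realType}.
Local Notation mu := (leb R).
Local Notation D := (@period R).
Local Notation meas f := (measurable_fun [set: lebR R] (f : lebR R -> R)).
Implicit Types (p q : \bar R) (f : R -> R).

(** The modulus of an extremal function in the duality between Lp and Lq: the
    value of the extremal function at t is the sign of f t times b (f t). The
    weight is a bounded function of the value f t alone, so that it is
    automatically periodic and reflects together with f. *)
Definition dual_weight p f (c : R) (b : R -> R) :=
  [/\ measurable_fun [set: R] b, (forall y, 0 <= b y),
      exists M, forall y, b y <= M,
      (Lp_norm p (EFin \o (b \o f)) <= 1)%E &
      (c%:E <= \int[mu]_(t in D) (`|f t| * b (f t))%:E)%E].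

Lemma dual_weight1 f c : meas f -> (c%:E < Lp_norm 1 (EFin \o f))%E ->
  exists b, dual_weight +oo f c b.
Proof.
move=> mf cf; exists (fun=> 1); split.
- exact: measurable_cst.
- by [].
- by exists 1.
- by apply/Lp_normyP => //; apply: aeW => t _ /=; rewrite normr1.
- by rewrite Lp_norm1 in cf; under eq_integral do rewrite mulr1; exact: ltW.
Qed.

(** Mass concentrated uniformly on the set where |f| > c, which is not null. *)
Lemma dual_weighty f c : meas f -> 0 <= c ->
  (c%:E < Lp_norm +oo (EFin \o f))%E -> exists b, dual_weight 1 f c b.
Proof.
move=> mf c0 cf; have mD := @measurable_period R.
have mcn : measurable_fun [set: R] (fun y : R => c < `|y|).
  by apply: measurable_fun_ltr; [exact: measurable_cst|exact: normr_measurable].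
pose E : set (lebR R) := D `&` [set t | c < `|f t|].
have mE : measurable E.
  apply: (measurableI _ _ mD).
  by rewrite -[X in measurable X]setTI; exact: (measurableT_comp mcn mf).
have Eoo : (mu E < +oo)%E.
  apply: (@le_lt_trans _ _ (mu D)); last by rewrite leb_period ltry.
  by apply: le_measure; rewrite ?inE//; exact: subIsetl.
have E0 : (0 < mu E)%E.
  rewrite lt_neqAle measure_ge0 andbT; apply/eqP => /esym E0.
  move: cf; rewrite ltNge => /negP; apply; apply/Lp_normyP => //.
  exists E; split => //; move=> t /= /not_implyP[Dt /negP].
  by rewrite lee_fin -ltNge => ?; split.
pose a := fine (mu E).
have aE : a%:E = mu E by rewrite fineK// ge0_fin_numE.
have a0 : 0 < a by rewrite -lte_fin aE.
pose b (y : R) := if c < `|y| then a^-1 else 0.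
have mb : measurable_fun [set: R] b.
  apply: measurable_fun_ifT; [exact: mcn|exact: measurable_cst|].
  exact: measurable_cst.
have b0 y : 0 <= b y by rewrite /b; case: ifP => // _; rewrite invr_ge0 ltW.
have intb (k : R) : 0 <= k ->
    (\int[mu]_(t in D) (k * b (f t))%:E = k%:E)%E.
  move=> k0; rewrite (_ : k%:E = \int[mu]_(t in E) (k * a^-1)%:E)%E; last first.
    by rewrite (integral_cst mu mE) -aE -EFinM divfK// gt_eqF.
  rewrite [RHS]integral_mkcond [LHS]integral_mkcond; apply: eq_integral => t _.
  rewrite /patch /b /E in_setI; case: ifPn => //= tD.
  have -> : (t \in [set t | c < `|f t|]) = (c < `|f t|).
    by apply/idP/idP => [/set_mem|/mem_set].
  by case: ifP => // _; rewrite mulr0.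
exists b; split => //.
- by exists a^-1 => y; rewrite /b; case: ifP => // _; rewrite invr_ge0 ltW.
- rewrite Lp_norm1 -[leRHS](intb 1)// le_eqVlt; apply/orP; left; apply/eqP.
  by apply: eq_integral => t _; rewrite mul1r /= ger0_norm.
- rewrite -[leLHS](intb c)//; apply: (@ge0_le_integral _ _ _ mu D mD).
  + by move=> t _; rewrite lee_fin mulr_ge0.
  + apply: measurable_funTS; apply/measurable_EFinP.
    apply: measurable_funM; first exact: measurable_cst.
    exact: (measurableT_comp mb).
  + apply: measurable_funTS; apply/measurable_EFinP.
    apply: measurable_funM; first by apply: measurableT_comp; first exact: normr_measurable.
    exact: (measurableT_comp mb).
  + move=> t _; rewrite lee_fin /b; case: ifP => [ct|_]; last by rewrite !mulr0.
    by apply: ler_wpM2r; [rewrite invr_ge0|]; exact: ltW.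
Qed.

(** The classical extremal weight |f|^(s - 1), normalised. The value is truncated
    at a level n to keep the weight bounded; by monotone convergence the norm of
    the truncation still exceeds c for n large. *)
Lemma dual_weight_fin (r s : R) f c : 1 < r -> 1 < s -> r^-1 + s^-1 = 1 ->
  meas f -> 0 <= c -> (c%:E < Lp_norm s%:E (EFin \o f))%E ->
  exists b, dual_weight r%:E f c b.
Proof.
move=> r1 s1 rs mf c0; have mD := @measurable_period R.
have r0 : 0 < r by exact: lt_trans r1.
have s0 : 0 < s by exact: lt_trans s1.
have rsE : r * (s - 1) = s.
  have : r * s * (r^-1 + s^-1) = r * s by rewrite rs mulr1.
  by rewrite mulrDr mulrC mulrA mulVf ?gt_eqF// mul1r mulfK ?gt_eqF//; lra.
rewrite (Lp_norm_fin f s0) => cf.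
set I := (\int[mu]_(t in D) _)%E in cf.
have I0 : (0 <= I)%E by apply: integral_ge0 => t _; rewrite lee_fin powR_ge0.
have cI : ((c `^ s)%:E < I)%E.
  move: cf I0; case: I => [i||]//; last by rewrite ltry.
  rewrite poweR_EFin !lte_fin lee_fin => ci i0.
  rewrite -[i](@powRr1 _ i)// -[1](@mulVf _ s) ?gt_eqF// powRrM.
  by apply: gt0_ltr_powR => //; rewrite nnegrE// powR_ge0.
pose tr (n : nat) (y : R) := Num.min `|y| n%:R.
have tr0 n y : 0 <= tr n y by rewrite le_min normr_ge0 ler0n.
have mtr n : measurable_fun [set: R] (tr n).
  by apply: measurable_minr; [exact: normr_measurable|exact: measurable_cst].
have mtrp n k : measurable_fun [set: R] (fun y => tr n y `^ k).
  exact: (measurableT_comp (measurable_powR k) (mtr n)).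
have mtrf n k : measurable_fun D (fun t : lebR R => (tr n (f t) `^ k)%:E).
  apply: measurable_funTS; apply/measurable_EFinP.
  exact: (measurableT_comp (mtrp n k) mf).
have [n cn] : exists n, ((c `^ s)%:E < \int[mu]_(t in D) (tr n (f t) `^ s)%:E)%E.
  have tr_nd x : {homo (fun n => (tr n (f x) `^ s)%:E) : i j / (i <= j)%N >-> (i <= j)%E}.
    move=> i j ij; rewrite lee_fin.
    apply: ge0_ler_powR; rewrite ?nnegrE//; first exact: ltW.
    by rewrite le_min /tr ge_min lexx/= ge_min ler_nat ij orbT.
  have tr_pos i (t : lebR R) : D t -> (0 <= (tr i (f t) `^ s)%:E)%E.
    by rewrite lee_fin powR_ge0.
  have := @cvg_monotone_convergence _ _ _ mu D mD
    (fun i t => (tr i (f t) `^ s)%:E) (mtrf^~ s) tr_pos (fun x _ => tr_nd x).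
  set L := (\int[mu]_(_ in _) _)%E.
  have -> : L = I.
    apply: eq_integral => t _; apply: lim_near_cst => //.
    exists (Num.truncn `|f t|).+1 => // k /= fk; congr (_ `^ _)%:E.
    apply/min_idPl; apply: le_trans (ltW (truncnS_gt _)) _.
    by rewrite ler_nat.
  move=> cvgI.
  have [n _ h] : \forall n \near \oo,
      ((c `^ s)%:E < \int[mu]_(t in D) (tr n (f t) `^ s)%:E)%E.
    apply: (cvgI [set y | ((c `^ s)%:E < y)%E]); apply: open_nbhs_nbhs.
    by split; [exact: open_ereal_gt_ereal|].
  by exists n; exact: h n (leqnn n).
set Se := (\int[mu]_(t in D) _)%E in cn.
have Sfin : Se \is a fin_num.
  rewrite ge0_fin_numE; last first.
    by apply: integral_ge0 => t _; rewrite lee_fin powR_ge0.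
  apply: (@le_lt_trans _ _ (\int[mu]_(t in D) (n%:R `^ s)%:E)%E).
    apply: (@ge0_le_integral _ _ _ mu D mD).
    - by move=> t _; rewrite lee_fin powR_ge0.
    - exact: mtrf.
    - exact: measurable_cst.
    - move=> t _; rewrite lee_fin.
      apply: ge0_ler_powR; rewrite ?nnegrE//; first exact: ltW.
      by rewrite ge_min lexx orbT.
  by rewrite (integral_cst mu mD) leb_period -EFinM ltry.
pose S := fine Se.
have SE : S%:E = Se by rewrite fineK.
have S0 : 0 < S.
  by rewrite -lte_fin SE; apply: le_lt_trans cn; rewrite lee_fin powR_ge0.
pose k := S `^ (- r^-1).
have k0 : 0 < k by rewrite powR_gt0.
have kr : k `^ r = S^-1.
  by rewrite /k -powRrM mulNr mulVf ?gt_eqF// powR_inv1// ltW.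
pose b y := tr n y `^ (s - 1) * k.
have b0 y : 0 <= b y by rewrite mulr_ge0 ?powR_ge0// ltW.
have intk (j : R) : 0 <= j ->
  (\int[mu]_(t in D) (j * tr n (f t) `^ s)%:E = (j * S)%:E)%E.
  move=> j0; under eq_integral do rewrite EFinM.
  have pos (t : lebR R) : D t -> (0 <= (tr n (f t) `^ s)%:E)%E.
    by rewrite lee_fin powR_ge0.
  by rewrite (ge0_integralZl_EFin mu mD pos (mtrf n s) j0) -/Se -SE.
exists b; split.
- by apply: measurable_funM; [exact: mtrp|exact: measurable_cst].
- exact: b0.
- exists (n%:R `^ (s - 1) * k) => y; apply: ler_wpM2r; first exact: ltW.
  apply: ge0_ler_powR; rewrite ?nnegrE//; first by rewrite subr_ge0 ltW.
  by rewrite ge_min lexx orbT.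
- suff H1 : (\int[mu]_(t in D) (`|(b \o f) t| `^ r)%:E = 1)%E.
    by rewrite (Lp_norm_fin _ r0) H1 poweR_EFin powR1.
  transitivity (\int[mu]_(t in D) (S^-1 * tr n (f t) `^ s)%:E)%E.
    apply: eq_integral => t _; congr EFin.
    rewrite /= ger0_norm// /b powRM ?powR_ge0 ?ltW// kr -powRrM.
    by rewrite [_ * r]mulrC rsE mulrC.
  by rewrite intk ?invr_ge0 ?ltW// mulVf// gt_eqF.
- apply: (@le_trans _ _ (\int[mu]_(t in D) (k * tr n (f t) `^ s)%:E)%E).
    rewrite (intk k (ltW k0)) lee_fin.
    have -> : k * S = S `^ s^-1.
      rewrite -[X in k * X](powRr1 (ltW S0)) -powRD; last first.
        by apply/implyP => _; rewrite gt_eqF.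
      by congr (_ `^ _); lra.
    have cS : c `^ s < S by rewrite -lte_fin SE.
    rewrite -[c](powRr1 c0) -[1](@mulfV _ s) ?gt_eqF// powRrM.
    apply: ge0_ler_powR; rewrite ?nnegrE ?powR_ge0 ?invr_ge0//; exact: ltW.
  apply: (@ge0_le_integral _ _ _ mu D mD).
  + by move=> t _; rewrite lee_fin mulr_ge0 ?powR_ge0// ltW.
  + apply/measurable_EFinP; apply: measurable_funM; first exact: measurable_cst.
    by apply/measurable_EFinP; exact: mtrf.
  + apply: measurable_funTS; apply/measurable_EFinP.
    apply: measurable_funM; first by apply: measurableT_comp; first exact: normr_measurable.
    apply: (measurableT_comp _ mf).
    by apply: measurable_funM; [exact: mtrp|exact: measurable_cst].
  + move=> t _; rewrite lee_fin /b [k * _]mulrC mulrA; apply: ler_wpM2r; first exact: ltW.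
    rewrite -(mulr_powRB1 (tr0 _ _) s0); apply: ler_wpM2r; first exact: powR_ge0.
    by rewrite ge_min lexx.
Qed.

End DualExtremal.

(** * The lower estimate *)

Section LowerBound.
Context {R : realType}.
Local Notation mu := (leb R).
Local Notation D := (@period R).
Local Notation P := (pi *+ 2 : R).
Local Notation meas f := (measurable_fun [set: lebR R] (f : lebR R -> R)).

(** The sign at 0 is taken to be 1, so that h has exactly the modulus of the
    weight. *)
Lemma dual_extremal (p q : \bar R) (f : R -> R) (c : R) :
  (1 <= p)%E -> (1 <= q)%E -> (p^-1 + q^-1 = 1)%E ->
  meas f -> (c%:E < Lp_norm q (EFin \o f))%E ->
  exists h : R -> R, [/\ measurable_fun [set: R] h, exists M, forall y, `|h y| <= M,
    (forall y, 0 <= y * h y), (Lp_norm p (EFin \o (h \o f)) <= 1)%E &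
    (c%:E <= \int[mu]_(t in D) (f t * h (f t))%:E)%E].
Proof.
move=> p1 q1 pq mf cf.
have [c0|c0] := leP 0 c; last first.
  exists (fun=> 0); split.
  - exact: measurable_cst.
  - by exists 0 => y; rewrite normr0.
  - by move=> y; rewrite mulr0.
  - rewrite /Lp_norm (_ : _ \_ _ = cst 0%E) ?Lnorm0 ?gt_eqF ?(lt_le_trans _ p1)//.
    by apply/funext => t; rewrite /patch; case: ifP.
  - by under eq_integral do rewrite mulr0; rewrite integral0 lee_fin ltW.
have [b [mb b0 [M bM] b1 cb]] : exists b, dual_weight p f c b.
  case: (conjugate_exponents_cases p1 q1 pq) cf => [||r s r1 s1 rs].
  - exact: dual_weighty.
  - exact: dual_weight1.
  - exact: dual_weight_fin.
pose sg (y : R) : R := if 0 <= y then 1 else -1.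
have msg : measurable_fun [set: R] sg.
  apply: measurable_fun_ifT; [|exact: measurable_cst|exact: measurable_cst].
  by apply: measurable_fun_ler; [exact: measurable_cst|exact: measurable_id].
have nsg y : `|sg y| = 1 by rewrite /sg; case: ifP; rewrite ?normrN normr1.
have sgE y : y * sg y = `|y|.
  rewrite /sg; case: (leP 0 y) => y0; first by rewrite mulr1 ger0_norm.
  by rewrite mulrN1 ltr0_norm.
have hE y : `|sg y * b y| = b y by rewrite normrM nsg mul1r ger0_norm.
exists (fun y => sg y * b y); split.
- exact: measurable_funM.
- by exists M => y; rewrite hE.
- by move=> y; rewrite mulrA sgE mulr_ge0.
- rewrite (@eq_norm_Lp_norm _ p _ (b \o f))// => t /=.
  by rewrite hE ger0_norm.
- by under eq_integral do rewrite mulrA sgE.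
Qed.

Section Singleton.
Context {m : nat}.
Variables (phi : R -> R) (e : 'rV[R]_m).

(** For single-valued g the Aumann integral is an ordinary vector integral. *)
Lemma sv_conv_single (K : R -> R) x :
  mu.-integrable D (fun t => (K (x - t)%R * phi t)%:E) ->
  sv_conv K (fun t => [set phi t *: e]) x =
  [set (\int[mu]_(t in D) (K (x - t) * phi t))%R *: e].
Proof.
move=> iK; have mD := @measurable_period R.
pose psi t := (K (x - t) * phi t) *: e.
have psiE i : (fun t => psi t 0 i) = (fun t => e 0 i * (K (x - t) * phi t)).
  by apply/funext => t; rewrite /psi mxE mulrC.
have ipsi : vec_integrable psi.
  move=> i; rewrite (_ : (fun t => _) = fun t => ((e 0 i)%:E * (K (x - t)%R * phi t)%:E)%E).
    exact: (integrableZl mD _ iK).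
  by apply/funext => t; rewrite -EFinM -(congr1 (fun u => u t) (psiE i)).
have psi_int : vec_integral psi = (\int[mu]_(t in D) (K (x - t) * phi t))%R *: e.
  apply/rowP => i; rewrite !mxE psiE mulrC.
  exact: (RintegralZl (e 0 i) mD iK).
apply/seteqP; split => [_ [psi' [ipsi' ae'] <-]|_ ->]; last first.
  exists psi => //; split => //; apply: aeW => t _.
  by exists (phi t *: e) => //; rewrite /psi scalerA.
rewrite /= -psi_int; apply/rowP => i; rewrite !mxE /Rintegral; congr fine.
apply: (ae_eq_integral _ _ mD).
- exact: (measurable_int _ (ipsi' i)).
- exact: (measurable_int _ (ipsi i)).
apply: filterS ae' => t h Dt; have [_ -> <-] := h Dt.
by rewrite /psi scalerA.
Qed.

End Singleton.

Variables (p q : \bar R).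
Hypotheses (p1 : (1 <= p)%E) (q1 : (1 <= q)%E) (pq : (p^-1 + q^-1 = 1)%E).

Lemma integrable_mul_bounded (f phi : R -> R) M : meas f -> meas phi ->
  mu.-integrable D (EFin \o f) -> (forall t, `|phi t| <= M) ->
  mu.-integrable D (fun t => (f t * phi t)%:E).
Proof.
move=> mf mphi iff phiM; have mD := @measurable_period R.
have iM : mu.-integrable D (fun t => (M%:E * (EFin \o f) t)%E).
  exact: integrableZl.
apply: (le_integrable mD _ _ iM).
  apply: measurable_funTS; apply/measurable_EFinP; exact: measurable_funM.
move=> t _; rewrite /= lee_fin !normrM mulrC ler_wpM2r//.
by apply: le_trans (phiM t) _; exact: ler_norm.
Qed.

Lemma Phi_single m (e : 'rV[R]_m) (phi : R -> R) : eucl_norm e = 1 ->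
  meas phi -> periodic phi P -> (Lp_norm p (EFin \o phi) <= 1)%E ->
  Phi p (fun t => [set phi t *: e]).
Proof.
move=> e1 mphi pphi phi1.
have nE : (fun t => set_norm [set phi t *: e]) = (fun t => (`|phi t|)%:E).
  by apply/funext => t; rewrite set_norm1 eucl_normZ e1 mulr1.
have mn : meas (fun t => `|phi t|).
  by apply: measurableT_comp; first exact: normr_measurable.
have n1 : (Lp_norm p (EFin \o (fun t => `|phi t|%R)) <= 1)%E.
  by rewrite (@eq_norm_Lp_norm _ p _ phi)// => t; rewrite normr_id.
have noo : (Lp_norm p (EFin \o (fun t => `|phi t|%R)) < +oo)%E.
  by apply: le_lt_trans n1 _; exact: ltry.
split; last by rewrite /dist_LpA; rewrite -/(set_norm _) in nE *; rewrite nE.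
split; last first.
  rewrite (_ : (fun x => _) = fun t => `|phi t|).
    by split => // t; rewrite pphi.
  by apply/funext => t; rewrite (congr1 (fun u => u t) nE).
split.
- by move=> t; split; [exists (phi t *: e)|exact: compact_set1].
- move=> U oU; rewrite (_ : [set _ | _] = phi @^-1` [set s : R | U (s *: e)]).
    rewrite -[X in measurable X]setTI; apply: mphi => //.
    apply: open_measurable; apply: (@open_comp _ _ (fun s : R => s *: e)) => //.
    by move=> s _; exact: scalel_continuous.
  apply/seteqP; split => t /=; first by move=> [_ [->]].
  by move=> Us; exists (phi t *: e).
- by move=> t; rewrite pphi.
- rewrite nE; apply: (@Lp_integrable _ q p) => //.
  by rewrite addeC.
Qed.

(** The essential supremum sees the values on [0, eta], a set of positive
    measure. *)
Lemma le_Lp_normy_near0 (F : R -> \bar R) (y eta : R) : 0 < eta -> eta <= P ->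
  (forall x, 0 <= x -> x <= eta -> (y%:E <= `|F x|)%E) ->
  (y%:E <= Lp_norm +oo F)%E.
Proof.
move=> eta0 etaP Fy; rewrite leNgt; apply/negP => Ly.
have /Lp_normyP : (Lp_norm +oo F <= Lp_norm +oo F)%E by [].
move=> /(_ (Lp_norm_ge0 _ _))[N [mN N0 sN]].
have : (mu (`[0%R, eta]%classic : set R) <= mu N)%E.
  apply: le_measure; rewrite ?inE//; first exact: measurable_lebR_itv.
  move=> x; rewrite /= in_itv/= => /andP[x0 xeta]; apply: sN => /= h.
  have Dx : D x by rewrite /period/= in_itv/= x0 (le_trans xeta).
  by have := lt_le_trans Ly (le_trans (Fy x x0 xeta) (h Dx)); rewrite ltxx.
by rewrite N0 leb_itv/= lte_fin eta0 -EFinB subr0 lee_fin leNgt eta0.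
Qed.

(** Take phi t = h (d (- t)) for d = K1 - K2 and h extremal, and g t = {phi t e}
    with e a unit vector. At x = 0 the distance of the two convolutions is the
    integral of d h(d), at least c. Since phi is bounded, continuity of
    translations in L1 preserves this up to e for x in an interval to the right
    of 0, so the essential supremum sees it. *)
Lemma dist_sv_conv_ge m (K1 K2 : R -> R) (c e : R) : (1 <= m)%N ->
  Lp q K1 -> Lp q K2 ->
  (c%:E < Lp_norm q (fun t => (K1 t - K2 t)%:E))%E -> 0 < e ->
  exists2 g, @Phi R m p g &
    ((c - e)%:E <= dist_LpA +oo (sv_conv K1 g) (sv_conv K2 g))%E.
Proof.
move=> m1 [mK1 pK1 K1oo] [mK2 pK2 K2oo] cK e0; have mD := @measurable_period R.
pose d t := K1 t - K2 t.
have md : meas d by exact: measurable_funB.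
have pd : periodic d P by move=> t; rewrite /d pK1 pK2.
have doo : (Lp_norm q (EFin \o d) < +oo)%E by exact: Lp_normB_lty.
have [h [mh [M hM] h0 h1 ch]] := dual_extremal p1 q1 pq md cK.
have M0 : 0 <= M by exact: le_trans (hM 0).
pose phi t := h (d (0 - t)).
have mhd : meas (h \o d) by exact: (measurableT_comp mh).
have phd : periodic (h \o d) P by move=> t /=; rewrite pd.
have mphi : meas phi by exact: (measurable_comp_refl 0 mhd).
have phiM t : `|phi t| <= M by exact: hM.
have pphi : periodic phi P.
  by move=> t; rewrite /phi -(pd (0 - (t + P))); congr (h (d _)); ring.
have phi1 : (Lp_norm p (EFin \o phi) <= 1)%E.
  exact: le_trans (Lp_norm_refl 0 p1 mhd phd) h1.
pose e1 : 'rV[R]_m := delta_mx 0 (Ordinal m1).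
have ne1 : eucl_norm e1 = 1.
  rewrite /eucl_norm (bigD1 (Ordinal m1))//= big1 ?addr0 => [|i im].
    by rewrite mxE !eqxx expr1n sqrtr1.
  by rewrite mxE (negbTE im) andbF expr0n.
pose g (t : R) := [set phi t *: e1].
exists g; first exact: Phi_single.
have iK (K : R -> R) x : meas K -> periodic K P -> (Lp_norm q (EFin \o K) < +oo)%E ->
    mu.-integrable D (fun t => (K (x - t)%R * phi t)%:E).
  move=> mK pK Koo.
  apply: (@integrable_mul_bounded (fun t => K (x - t)) phi M _ mphi _ phiM).
    exact: measurable_comp_refl.
  apply: (Lp_integrable p1 q1 pq); first exact: measurable_comp_refl.
  exact: le_lt_trans (Lp_norm_refl x q1 mK pK) Koo.
pose I x := (\int[mu]_(t in D) (d (x - t) * phi t))%R.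
have distE x : hausdorff_dist (sv_conv K1 g x) (sv_conv K2 g x) = (`|I x|)%:E.
  rewrite !sv_conv_single; [|exact: iK..].
  rewrite hausdorff_dist11 -scalerBl eucl_normZ ne1 mulr1.
  rewrite -(RintegralB mD (iK _ x mK1 pK1 K1oo) (iK _ x mK2 pK2 K2oo)).
  by congr (`|_|%:E); apply: eq_Rintegral => t _; rewrite /d mulrBl.
have I0 : c <= I 0.
  rewrite -lee_fin; apply: le_trans ch _.
  rewrite /I /Rintegral fineK; last exact: (integrable_fin_num mD (iK _ 0 md pd doo)).
  rewrite le_eqVlt; apply/orP; left; apply/eqP/esym.
  apply: (@ge0_integral_period_refl _ d (fun y => (y * h y)%:E) 0 md pd).
    by apply/measurable_EFinP; apply: measurable_funM; [exact: measurable_id|].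
  by move=> y; rewrite lee_fin.
(* M may be 0, hence the division by M + 1 *)
have M1 : 0 < M + 1 by rewrite ltr_wpDl.
have e20 : 0 < e / (M + 1) by rewrite divr_gt0.
have [eta eta0 heta] := translation_continuous md pd (Lp_integrable p1 q1 pq md doo) e20.
have P0 : 0 < P by rewrite mulrn_wgt0 ?pi_gt0.
apply: (@le_Lp_normy_near0 _ _ (Num.min eta P)).
- by rewrite lt_min eta0.
- by rewrite ge_min lexx orbT.
move=> x x0; rewrite le_min => /andP[xeta _].
rewrite distE /= normr_id lee_fin.
suff II : `|I x - I 0| <= e.
  have := ler_norm (I x); move: II; rewrite ler_norml => /andP[].
  lra.
rewrite /I -(RintegralB mD (iK _ x md pd doo) (iK _ 0 md pd doo)).
have idd : mu.-integrable D (fun t => (d (x - t)%R * phi t - d (0 - t)%R * phi t)%:E).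
  exact: (integrableB mD (iK _ x md pd doo) (iK _ 0 md pd doo)).
apply: le_trans (le_normr_Rintegral mD idd) _.
rewrite -lee_fin /Rintegral fineK; last first.
  exact: (integrable_fin_num mD (integrable_norm idd)).
have mdd : meas (fun t => `|d (x - t) - d (- t)|).
  apply: measurableT_comp; first exact: normr_measurable.
  apply: measurable_funB; first exact: measurable_comp_refl.
  have := measurable_comp_refl 0 md; under eq_fun do rewrite sub0r; exact.
apply: (@le_trans _ _ (\int[mu]_(t in D) (M%:E * (`|d (x - t)%R - d (- t)%R|)%:E))%E).
  apply: (@ge0_le_integral _ _ _ mu D mD).
  - by move=> t _; rewrite lee_fin.
  - exact: (measurable_int _ (integrable_norm idd)).
  - by apply: measurable_funeM; apply: measurable_funTS; exact/measurable_EFinP.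
  - move=> t _; rewrite -EFinM lee_fin -mulrBl normrM mulrC sub0r.
    by apply: ler_wpM2r.
rewrite (ge0_integralZl_EFin mu mD _ _ M0); last 2 first.
- by move=> t _; rewrite lee_fin.
- by apply: measurable_funTS; exact/measurable_EFinP.
apply: (@le_trans _ _ (M%:E * (e / (M + 1))%:E)%E).
  by apply: lee_wpmul2l; [rewrite lee_fin|exact: heta].
rewrite -EFinM lee_fin mulrCA; apply: ler_piMr; first exact: ltW.
by rewrite ler_pdivrMr// mul1r lerDl.
Qed.

End LowerBound.

(** * The deviation of the convolution class *)

Theorem theorem4 (R : realType) (m : nat) (hm : (1 <= m)%N)
    (n : nat) (hn : (1 <= n)%N) (p q : \bar R)
    (hp : (1 <= p)%E) (hq : (1 <= q)%E) (hpq : (p^-1 + q^-1 = 1)%E)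
    (K : R -> R) (hK : Lp q K) :
  convolution_deviation m n p K = best_approx n q K.
Proof.
rewrite /convolution_deviation /best_approx.
suff sup_dist T : trig_poly n T ->
    ereal_sup [set dist_LpA +oo%E (sv_conv K g) (sv_conv T g) | g in @Phi R m p] =
    Lp_norm q (fun x => (K x - T x)%:E).
  by congr ereal_inf; apply/seteqP; split => _ [T tT <-]; exists T => //;
    rewrite sup_dist.
move=> tT; have LT := trig_poly_Lp hq tT.
apply/eqP; rewrite eq_le; apply/andP; split.
  by apply: ge_ereal_sup => _ [g Pg <-]; exact: (dist_sv_conv_le hp hq hpq).
have [[mK pK Koo] [mT pT Too]] := (hK, LT).
have doo : (Lp_norm q (fun x => (K x - T x)%:E) < +oo)%E.
  exact: Lp_normB_lty.
set L := Lp_norm q _ in doo *.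
have LE : (fine L)%:E = L by rewrite fineK// ge0_fin_numE// Lp_norm_ge0.
apply/lee_addgt0Pr => e e0; rewrite -leeBlDr// -LE -EFinB.
have e20 : 0 < e / 2 by rewrite divr_gt0.
have cL : ((fine L - e / 2)%:E < L)%E by rewrite -LE lte_fin gtrBl.
have [g Pg Lg] := dist_sv_conv_ge hp hq hpq hm hK LT cL e20.
apply: (@le_trans _ _ (fine L - e / 2 - e / 2)%:E); first by rewrite lee_fin; lra.
by apply: le_trans Lg _; apply: ereal_sup_ubound; exists g.
Qed.
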